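(* Let $F\colon GK^G\to D$ be a functor (not necessarily additive) into a category $D$. Then $F$ is faithful if and only if the restriction of $F$ to the subcategory $L_0GK^G$ is faithful.
   Context: Throughout, $G$ is a discrete group. All rings are associative, not necessarily commutative or unital, and carry a $G$-action $\alpha\colon G\to\mathrm{Aut}(A)$; ring homomorphisms are $G$-equivariant. A ring $A$ is quadratik if every element is a finite sum of products $ab$, $a,b\in A$. For a ring $(A,\alpha)$, a $G$-action on a right $A$-module $M$ is a homomorphism $S$ from $G$ into the additive bijections of $M$ with $S_g(\xi a)=S_g(\xi)\alpha_g(a)$; $\mathrm{Hom}_A(M,N)$ carries the action $\varphi\mapsto T_g\circ\varphi\circ S_{g^{-1}}$. A right functional $A$-module is a right $A$-module $\mathcal E$ with $G$-action $S$ and a $G$-invariant left $A$-submodule $\Theta_A(\mathcal E)\subseteq \mathrm{Hom}_A(\mathcal E,A)$ (the functional space; $(a\varphi)(\xi)=a\varphi(\xi)$). The compact operators $\mathcal K_A(\mathcal E)$ are the finite sums of $\theta_{\eta,\varphi}(\xi)=\eta\varphi(\xi)$ ($\eta\in\mathcal E,\varphi\in\Theta_A(\mathcal E)$), a ring with $G$-action $T\mapsto S_gTS_{g^{-1}}$. $\mathcal E$ is cofull if each element is a finite sum of elements $\xi\varphi(\eta)$. A quadratik ring $A$ is a functional module over itself with functionals given by left multiplications by elements of $A$; direct sums carry diagonal action and functionals $\oplus\xi_i\mapsto\sum\varphi_i(\xi_i)$. Corner embedding: for a ring $(A,\alpha)$, a right functional $A$-module $\mathcal E$ and $\mathcal H_A=\bigoplus_{i\in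 I}A$ ($I\neq\emptyset$) with a $G$-action of the form $\alpha\oplus T$ (the copy at a distinguished index carries $\alpha$, $T$ arbitrary on the rest) such that $\mathcal E\oplus\mathcal H_A$ is cofull, the map $e\colon A\to\mathcal K_A(\mathcal E\oplus\mathcal H_A)$, $e(a)(\xi\oplus b\oplus\eta)=0\oplus ab\oplus 0$ ($b$ the distinguished coordinate) is a corner embedding (also up to ring isomorphism). Homotopy: $f_0,f_1\colon A\to B$ are homotopic if there is an equivariant ring homomorphism $f\colon A\to B\otimes_{\mathbb Z} C([0,1],\mathbb C)$ (trivial action on $C[0,1]$) whose evaluations at $0,1$ land in $B\otimes\mathbb Z\cong B$ and equal $f_0,f_1$. $GK^G$: objects are the $G$-equivariant quadratik rings of a fixed set-sized class closed under the constructions used; morphisms are generated by the equivariant ring homomorphisms, a formal inverse $e^{-1}$ for each corner embedding $e$, and for each split exact sequence $0\to B\xrightarrow{j}M\xrightarrow{f}A\to 0$ with equivariant ring homomorphism $s\colon A\to M$ splitting $f$ a morphism $\Delta_s\colon M\to B$, with free addition/subtraction of parallel morphisms, modulo: composition of ring homomorphisms, identities, $1_{A\oplus B}=p_Ai_A+p_Bi_B$, homotopic homomorphisms are equal, $e^{-1}$ is inverse to $e$, $j\Delta_s=1_B$, $\Delta_sj+fs=1_M$. Composition is written left to right ($fg$ = first $f$, then $g$). $L_0GK^G$ is the additive subcategory of $GK^G$ with the same objects whose morphisms $A\to B$ are the finite sums $\pm f_1\pm\dots\pm f_n$ of ring homomorphisms $f_i\colon A\to B$. *)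

(* Defs.v *)
From Stdlib Require Import List Reals.
From Coquelicot Require Import Coquelicot.
Import ListNotations.
Set Implicit Arguments.
Unset Strict Implicit.

Record Grp := {
  gcar :> Type;
  gmul : gcar -> gcar -> gcar;
  gone : gcar;
  ginv : gcar -> gcar;
  gassoc : forall x y z, gmul x (gmul y z) = gmul (gmul x y) z;
  gunitl : forall x, gmul gone x = x;
  gunitr : forall x, gmul x gone = x;
  ginvl : forall x, gmul (ginv x) x = gone }.

Definition abgrp_laws (T : Type) (add : T -> T -> T) (zero : T) (opp : T -> T) : Prop :=
  (forall x y z, add x (add y z) = add (add x y) z) /\
  (forall x y, add x y = add y x) /\
  (forall x, add zero x = x) /\
  (forall x, add (opp x) x = zero).

Record AbGrp := {
  acar :> Type;
  aadd : acar -> acar -> acar;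
  azero : acar;
  aopp : acar -> acar;
  a_ab : abgrp_laws aadd azero aopp }.

Record GRing (G : Grp) := {
  rcar :> Type;
  radd : rcar -> rcar -> rcar;
  rzero : rcar;
  ropp : rcar -> rcar;
  rmul : rcar -> rcar -> rcar;
  r_ab : abgrp_laws radd rzero ropp;
  rmul_assoc : forall x y z, rmul x (rmul y z) = rmul (rmul x y) z;
  rmul_addl : forall x y z, rmul (radd x y) z = radd (rmul x z) (rmul y z);
  rmul_addr : forall x y z, rmul x (radd y z) = radd (rmul x y) (rmul x z);
  ract : gcar G -> rcar -> rcar;
  ract_add : forall g x y, ract g (radd x y) = radd (ract g x) (ract g y);
  ract_mul : forall g x y, ract g (rmul x y) = rmul (ract g x) (ract g y);
  ract_one : forall x, ract (gone G) x = x;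
  ract_comp : forall g h x, ract (gmul g h) x = ract g (ract h x) }.

Definition toAb (G : Grp) (A : GRing G) : AbGrp :=
  {| acar := A; aadd := @radd G A; azero := rzero A; aopp := @ropp G A; a_ab := r_ab A |}.

Definition rsum (G : Grp) (A : GRing G) (l : list A) : A :=
  fold_right (@radd G A) (rzero A) l.

Definition quadratik (G : Grp) (A : GRing G) : Prop :=
  forall x : A, exists l : list (A * A)%type,
    x = rsum (map (fun p => rmul (fst p) (snd p)) l).

Record RHom (G : Grp) (A B : GRing G) := {
  hfun :> A -> B;
  hadd : forall x y, hfun (radd x y) = radd (hfun x) (hfun y);
  hmul : forall x y, hfun (rmul x y) = rmul (hfun x) (hfun y);
  hequiv : forall g x, hfun (ract g x) = ract g (hfun x) }.

Definition isid (G : Grp) (A : GRing G) (h : RHom A A) : Prop := forall x, h x = x.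

Definition additive (X Y : AbGrp) (h : X -> Y) : Prop :=
  forall x y, h (aadd x y) = aadd (h x) (h y).

Lemma rmul0l (G : Grp) (A : GRing G) (a : A) : rmul (rzero A) a = rzero A.
Proof.
  destruct (r_ab A) as [Has [Hc [H0 Hn]]].
  assert (Hz : rmul (rzero A) a = radd (rmul (rzero A) a) (rmul (rzero A) a))
    by (rewrite <- rmul_addl, H0; reflexivity).
  assert (E : radd (ropp (rmul (rzero A) a)) (radd (rmul (rzero A) a) (rmul (rzero A) a))
            = radd (ropp (rmul (rzero A) a)) (rmul (rzero A) a)) by (rewrite <- Hz; reflexivity).
  rewrite Has, Hn, H0 in E. exact E.
Qed.

Record RMod (G : Grp) (A : GRing G) := {
  mcar :> Type;
  madd : mcar -> mcar -> mcar;
  mzero : mcar;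
  mopp : mcar -> mcar;
  m_ab : abgrp_laws madd mzero mopp;
  mact : mcar -> A -> mcar;
  mact_addl : forall x y a, mact (madd x y) a = madd (mact x a) (mact y a);
  mact_addr : forall x a b, mact x (radd a b) = madd (mact x a) (mact x b);
  mact_mul : forall x a b, mact x (rmul a b) = mact (mact x a) b;
  mS : gcar G -> mcar -> mcar;
  mS_add : forall g x y, mS g (madd x y) = madd (mS g x) (mS g y);
  mS_act : forall g x a, mS g (mact x a) = mact (mS g x) (ract g a);
  mS_one : forall x, mS (gone G) x = x;
  mS_comp : forall g h x, mS (gmul g h) x = mS g (mS h x) }.

Record FMod (G : Grp) (A : GRing G) := {
  fmod :> RMod A;
  Theta : (fmod -> A) -> Prop;
  Theta_hom : forall phi, Theta phi ->
     (forall x y, phi (madd x y) = radd (phi x) (phi y)) /\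
     (forall x a, phi (mact x a) = rmul (phi x) a);
  Theta_zero : Theta (fun _ => rzero A);
  Theta_add : forall phi psi, Theta phi -> Theta psi -> Theta (fun x => radd (phi x) (psi x));
  Theta_opp : forall phi, Theta phi -> Theta (fun x => ropp (phi x));
  Theta_lmul : forall a phi, Theta phi -> Theta (fun x => rmul a (phi x));
  Theta_inv : forall g phi, Theta phi -> Theta (fun x => ract g (phi (mS (ginv g) x))) }.

Definition fs (G : Grp) (A : GRing G) (I : Type) : Type :=
  { f : I -> A | exists l : list I, forall i, ~ In i l -> f i = rzero A }.

Definition fs_val (G : Grp) (A : GRing G) (I : Type) (f : fs A I) : I -> A := proj1_sig f.

Definition fs_zero (G : Grp) (A : GRing G) (I : Type) : fs A I :=
  exist _ (fun _ => rzero A) (ex_intro _ nil (fun _ _ => eq_refl)).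

Lemma fs_add_pf (G : Grp) (A : GRing G) (I : Type) (f g : fs A I) :
  exists l : list I, forall i, ~ In i l -> radd (fs_val f i) (fs_val g i) = rzero A.
Proof.
  destruct f as [f [l1 H1]], g as [g [l2 H2]]; simpl.
  exists (l1 ++ l2); intros i Hi.
  rewrite H1, H2 by (intro; apply Hi; apply in_or_app; auto).
  destruct (r_ab A) as [_ [_ [H0 _]]]; apply H0.
Qed.

Definition fs_add (G : Grp) (A : GRing G) (I : Type) (f g : fs A I) : fs A I :=
  exist _ (fun i => radd (fs_val f i) (fs_val g i)) (fs_add_pf f g).

Lemma fs_act_pf (G : Grp) (A : GRing G) (I : Type) (f : fs A I) (a : A) :
  exists l : list I, forall i, ~ In i l -> rmul (fs_val f i) a = rzero A.
Proof.
  destruct f as [f [l H]]; simpl; exists l; intros i Hi.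
  rewrite H by exact Hi; apply rmul0l.
Qed.

Definition fs_act (G : Grp) (A : GRing G) (I : Type) (f : fs A I) (a : A) : fs A I :=
  exist _ (fun i => rmul (fs_val f i) a) (fs_act_pf f a).

(* The module  E (+) H_A  with  H_A = A (+) (+)_{i in I'} A,  the distinguished copy
   of A carrying alpha and an arbitrary G-action T on the remaining summand. *)
Section Corner.
Variables (G : Grp) (A : GRing G) (E : FMod A) (I' : Type) (T : gcar G -> fs A I' -> fs A I').

Definition Mty : Type := (E * A * fs A I')%type.

Definition addM (m m' : Mty) : Mty :=
  match m, m' with (x, b, h), (x', b', h') => (madd x x', radd b b', fs_add h h') end.
Definition zeroM : Mty := (mzero E, rzero A, fs_zero A I').
Definition actM (m : Mty) (a : A) : Mty :=
  match m with (x, b, h) => (mact x a, rmul b a, fs_act h a) end.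
Definition SM (g : gcar G) (m : Mty) : Mty :=
  match m with (x, b, h) => (mS g x, ract g b, T g h) end.
Definition sumM (l : list Mty) : Mty := fold_right addM zeroM l.

Definition T_action : Prop :=
  (forall g h h', T g (fs_add h h') = fs_add (T g h) (T g h')) /\
  (forall g h a, T g (fs_act h a) = fs_act (T g h) (ract g a)) /\
  (forall h, T (gone G) h = h) /\
  (forall g g' h, T (gmul g g') h = T g (T g' h)).

Definition ThetaM (psi : Mty -> A) : Prop :=
  exists (phi : E -> A) (c : A) (l : list (I' * A)%type),
    Theta phi /\
    psi = fun m => match m with (x, b, h) =>
       radd (phi x) (radd (rmul c b) (rsum (map (fun p => rmul (snd p) (fs_val h (fst p))) l)))
    end.

Definition compactM (K : Mty -> Mty) : Prop :=
  exists (l : list (Mty * (Mty -> A))%type),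
    List.Forall (fun p => ThetaM (snd p)) l /\
    forall m, K m = sumM (map (fun p => actM (fst p) (snd p m)) l).

Definition cofullM : Prop :=
  forall m : Mty, exists (l : list (Mty * (Mty -> A) * Mty)%type),
    List.Forall (fun p => ThetaM (snd (fst p))) l /\
    m = sumM (map (fun p => actM (fst (fst p)) (snd (fst p) (snd p))) l).

Definition e0 (a : A) : Mty -> Mty :=
  fun m => match m with (_, b, _) => (mzero E, rmul a b, fs_zero A I') end.
End Corner.

(* e : A -> B is a corner embedding (up to ring isomorphism of the target):
   B is isomorphic, via psi, to K_A(E (+) H_A) with its conjugation action,
   and psi o e = e0. *)
Definition corner (G : Grp) (A B : GRing G) (e : RHom A B) : Prop :=
  exists (E : FMod A) (I' : Type) (T : gcar G -> fs A I' -> fs A I'),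
    T_action T /\ cofullM E I' /\
    exists psi : B -> (Mty E I' -> Mty E I'),
      (forall x y, psi (radd x y) = fun m => addM (psi x m) (psi y m)) /\
      (forall x y, psi (rmul x y) = fun m => psi x (psi y m)) /\
      (forall x y, psi x = psi y -> x = y) /\
      (forall K, compactM (E := E) (I' := I') K <-> exists b, psi b = K) /\
      (forall g b, psi (ract g b) = fun m => SM T g (psi b (SM T (ginv g) m))) /\
      (forall a, psi (e a) = e0 (E := E) (I' := I') a).

Definition splitex (G : Grp) (B M A : GRing G) (j : RHom B M) (f : RHom M A) (s : RHom A M) : Prop :=
  (forall x y, j x = j y -> x = y) /\
  (forall m, (exists b, j b = m) <-> f m = rzero A) /\
  (forall a, exists m, f m = a) /\
  (forall a, f (s a) = a).

Definition I01 : Type := { x : R | 0 <= x <= 1 }.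
Definition pt0 : I01 := exist _ 0 (conj (Rle_refl 0) Rle_0_1).
Definition pt1 : I01 := exist _ 1 (conj Rle_0_1 (Rle_refl 1)).
Definition C01 : Type :=
  { f : I01 -> C | forall x eps, 0 < eps -> exists d, 0 < d /\
       forall y, Rabs (proj1_sig y - proj1_sig x) < d -> Cmod (Cminus (f y) (f x)) < eps }.
Definition cval (c : C01) : I01 -> C := proj1_sig c.

Section Tensor.
Variables (G : Grp) (B : GRing G).

Definition biadd01 (X : AbGrp) (beta : B -> C01 -> X) : Prop :=
  (forall b b' c, beta (radd b b') c = aadd (beta b c) (beta b' c)) /\
  (forall b c c' c'', (forall x, cval c'' x = Cplus (cval c x) (cval c' x)) ->
      beta b c'' = aadd (beta b c) (beta b c')).

Definition is_tensor01 (P : AbGrp) (t : B -> C01 -> P) : Prop :=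
  biadd01 t /\
  forall (X : AbGrp) (beta : B -> C01 -> X), biadd01 beta ->
    exists h : P -> X, (additive h /\ forall b c, h (t b c) = beta b c) /\
      forall h' : P -> X, additive h' -> (forall b c, h' (t b c) = beta b c) -> h' = h.

Definition biaddC (X : AbGrp) (beta : B -> C -> X) : Prop :=
  (forall b b' c, beta (radd b b') c = aadd (beta b c) (beta b' c)) /\
  (forall b c c', beta b (Cplus c c') = aadd (beta b c) (beta b c')).

Definition is_tensorC (Q : AbGrp) (t : B -> C -> Q) : Prop :=
  biaddC t /\
  forall (X : AbGrp) (beta : B -> C -> X), biaddC beta ->
    exists h : Q -> X, (additive h /\ forall b c, h (t b c) = beta b c) /\
      forall h' : Q -> X, additive h' -> (forall b c, h' (t b c) = beta b c) -> h' = h.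
End Tensor.

(* f0 ~ f1 : there is an equivariant ring hom f : A -> B (x) C([0,1],C) (trivial action
   on C[0,1]) whose evaluations at 0 and 1 (maps into B (x) C) equal f0, f1 composed
   with the inclusion B = B (x) Z -> B (x) C, b |-> b (x) 1. *)
Definition homotopic (G : Grp) (A B : GRing G) (f0 f1 : RHom A B) : Prop :=
  exists (P : GRing G) (t : B -> C01 -> P) (Q : AbGrp) (tq : B -> C -> Q) (f : RHom A P),
    is_tensor01 (P := toAb P) t /\
    (forall b c b' c' c'', (forall x, cval c'' x = Cmult (cval c x) (cval c' x)) ->
        rmul (t b c) (t b' c') = t (rmul b b') c'') /\
    (forall g b c, ract g (t b c) = t (ract g b) c) /\
    is_tensorC tq /\
    (forall h : P -> Q, additive (X := toAb P) h -> (forall b c, h (t b c) = tq b (cval c pt0)) ->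
        forall a, h (f a) = tq (f0 a) (RtoC 1)) /\
    (forall h : P -> Q, additive (X := toAb P) h -> (forall b c, h (t b c) = tq b (cval c pt1)) ->
        forall a, h (f a) = tq (f1 a) (RtoC 1)).

Record Obj (G : Grp) := { oring :> GRing G; oquad : quadratik oring }.

Inductive mor (G : Grp) : Obj G -> Obj G -> Type :=
| mhom (A B : Obj G) : RHom A B -> mor A B
| minv (A B : Obj G) (e : RHom A B) : corner e -> mor B A
| mdelta (Bo Mo Ao : Obj G) (j : RHom Bo Mo) (f : RHom Mo Ao) (s : RHom Ao Mo) :
    splitex j f s -> mor Mo Bo
| mcomp (A B C : Obj G) : mor A B -> mor B C -> mor A C
| mplus (A B : Obj G) : mor A B -> mor A B -> mor A B
| mneg (A B : Obj G) : mor A B -> mor A B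
| mzr (A B : Obj G) : mor A B.

Arguments mhom {G A B}.
Arguments minv {G A B}.
Arguments mdelta {G Bo Mo Ao}.
Arguments mcomp {G A B C}.
Arguments mplus {G A B}.
Arguments mneg {G A B}.
Arguments mzr {G A B}.

Inductive meq (G : Grp) : forall A B : Obj G, mor A B -> mor A B -> Prop :=
| meq_refl (A B : Obj G) (s : mor A B) : meq s s
| meq_sym (A B : Obj G) (s t : mor A B) : meq s t -> meq t s
| meq_trans (A B : Obj G) (s t u : mor A B) : meq s t -> meq t u -> meq s u
| meq_comp (A B C : Obj G) (s s' : mor A B) (t t' : mor B C) :
    meq s s' -> meq t t' -> meq (mcomp s t) (mcomp s' t')
| meq_plus (A B : Obj G) (s s' t t' : mor A B) : meq s s' -> meq t t' -> meq (mplus s t) (mplus s' t')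
| meq_neg (A B : Obj G) (s s' : mor A B) : meq s s' -> meq (mneg s) (mneg s')
| meq_assoc (A B C D : Obj G) (s : mor A B) (t : mor B C) (u : mor C D) :
    meq (mcomp s (mcomp t u)) (mcomp (mcomp s t) u)
| meq_idl (A B : Obj G) (h : RHom A A) (s : mor A B) : isid h -> meq (mcomp (mhom h) s) s
| meq_idr (A B : Obj G) (h : RHom B B) (s : mor A B) : isid h -> meq (mcomp s (mhom h)) s
| meq_plusA (A B : Obj G) (s t u : mor A B) : meq (mplus s (mplus t u)) (mplus (mplus s t) u)
| meq_plusC (A B : Obj G) (s t : mor A B) : meq (mplus s t) (mplus t s)
| meq_plus0 (A B : Obj G) (s : mor A B) : meq (mplus mzr s) s
| meq_plusN (A B : Obj G) (s : mor A B) : meq (mplus (mneg s) s) mzr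
| meq_distl (A B C : Obj G) (s t : mor A B) (u : mor B C) :
    meq (mcomp (mplus s t) u) (mplus (mcomp s u) (mcomp t u))
| meq_distr (A B C : Obj G) (u : mor A B) (s t : mor B C) :
    meq (mcomp u (mplus s t)) (mplus (mcomp u s) (mcomp u t))
| meq_homcomp (A B C : Obj G) (f : RHom A B) (g : RHom B C) (h : RHom A C) :
    (forall x, h x = g (f x)) -> meq (mcomp (mhom f) (mhom g)) (mhom h)
| meq_sum (A B D : Obj G) (pA : RHom D A) (iA : RHom A D) (pB : RHom D B) (iB : RHom B D)
    (idD : RHom D D) :
    isid idD ->
    (forall a, pA (iA a) = a) -> (forall b, pB (iB b) = b) ->
    (forall a, pB (iA a) = rzero B) -> (forall b, pA (iB b) = rzero A) ->
    (forall d, d = radd (iA (pA d)) (iB (pB d))) ->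
    meq (mhom idD) (mplus (mcomp (mhom pA) (mhom iA)) (mcomp (mhom pB) (mhom iB)))
| meq_htp (A B : Obj G) (f0 f1 : RHom A B) : homotopic f0 f1 -> meq (mhom f0) (mhom f1)
| meq_inv1 (A B : Obj G) (e : RHom A B) (H : corner e) (idA : RHom A A) :
    isid idA -> meq (mcomp (mhom e) (minv e H)) (mhom idA)
| meq_inv2 (A B : Obj G) (e : RHom A B) (H : corner e) (idB : RHom B B) :
    isid idB -> meq (mcomp (minv e H) (mhom e)) (mhom idB)
| meq_delta1 (Bo Mo Ao : Obj G) (j : RHom Bo Mo) (f : RHom Mo Ao) (s : RHom Ao Mo)
    (H : splitex j f s) (idB : RHom Bo Bo) :
    isid idB -> meq (mcomp (mhom j) (mdelta j f s H)) (mhom idB)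
| meq_delta2 (Bo Mo Ao : Obj G) (j : RHom Bo Mo) (f : RHom Mo Ao) (s : RHom Ao Mo)
    (H : splitex j f s) (idM : RHom Mo Mo) :
    isid idM ->
    meq (mplus (mcomp (mdelta j f s H) (mhom j)) (mcomp (mhom f) (mhom s))) (mhom idM).

Arguments meq {G A B}.

Definition signed_sum (G : Grp) (A B : Obj G) (l : list (bool * RHom A B)%type) : mor A B :=
  fold_right (fun (p : (bool * RHom A B)%type) (acc : mor A B) => mplus (if fst p then mhom (snd p) else mneg (mhom (snd p))) acc)
             mzr l.

Definition inL0 (G : Grp) (A B : Obj G) (s : mor A B) : Prop :=
  exists l : list (bool * RHom A B)%type, meq s (signed_sum l).

Record Cat := {
  cob : Type;
  chom : cob -> cob -> Type;
  cid : forall a, chom a a;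
  ccomp : forall a b c, chom a b -> chom b c -> chom a c;
  cassoc : forall a b c d (f : chom a b) (g : chom b c) (h : chom c d),
      ccomp f (ccomp g h) = ccomp (ccomp f g) h;
  cidl : forall a b (f : chom a b), ccomp (cid a) f = f;
  cidr : forall a b (f : chom a b), ccomp f (cid b) = f }.

Record GKFunctor (G : Grp) (D : Cat) := {
  Fob : Obj G -> cob D;
  Fmor : forall A B : Obj G, mor A B -> @chom D (Fob A) (Fob B);
  Fresp : forall A B (s t : mor A B), meq s t -> Fmor s = Fmor t;
  Fcomp : forall A B C (s : mor A B) (t : mor B C), Fmor (mcomp s t) = ccomp (Fmor s) (Fmor t);
  Fid : forall (A : Obj G) (h : RHom A A), isid h -> Fmor (mhom h) = @cid D (Fob A) }.

Arguments Fmor {G D} g {A B}.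

Definition faithful (G : Grp) (D : Cat) (F : GKFunctor G D) : Prop :=
  forall (A B : Obj G) (s t : mor A B), Fmor F s = Fmor F t -> meq s t.

Definition faithful_L0 (G : Grp) (D : Cat) (F : GKFunctor G D) : Prop :=
  forall (A B : Obj G) (s t : mor A B), inL0 s -> inL0 t -> Fmor F s = Fmor F t -> meq s t.

(* Main.v *)
(* A homomorphism is called good here if it is a composite of corner embeddings and of
   inclusions of split ideals; good homomorphisms are split monomorphisms of [GK^G].  Every
   morphism becomes an element of [L_0] after composition on the right with a good
   homomorphism, so any two parallel morphisms can be compared inside [L_0].

   The generators satisfy this because [e^-1 e = 1] and [Delta_s j = 1 - f s].  For composites
   one needs an Ore condition: given [v : B -> B'] good and [h : B -> C], there are [v'] good
   and [h'] with [h v' = v h'].  For a generator [v], let [X] be the right [C]-module induced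
   by [h] from [B' v(B)], with its left action of [B'].  If [v] is a corner embedding, [B'] acts
   by compact operators on [X]; if it is a split ideal with complement [A], the image of [B']
   lies in the semidirect product of the compact operators on [X + C] by [A].  This yields [h'],
   and [v'] is the corner embedding of [C] on the second summand.  The two resulting
   homomorphisms from [B], one acting on [X] and one on [C], are the diagonal corners of a
   homomorphism on [M_2(B)], so it remains to see that both embeddings of [B] into [M_2(B)] agree
   in [GK^G]: they differ by conjugation with a permutation matrix, which is trivial by
   matrix stability alone. *)

From Stdlib Require Import List FunctionalExtensionality ProofIrrelevance ClassicalEpsilon.
From Stdlib Require Import ssreflect.
Require Import Defs.
Import ListNotations.
Set Implicit Arguments.
Unset Strict Implicit.

(** * Abelian groups, rings and the calculus of morphisms *)

Section AbelianGroups.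
Variables (T : Type) (add : T -> T -> T) (zero : T) (opp : T -> T).
Hypothesis H : abgrp_laws add zero opp.

Lemma ab_assoc x y z : add x (add y z) = add (add x y) z.
Proof. by case: H. Qed.

Lemma ab_comm x y : add x y = add y x.
Proof. by case: H => _ []. Qed.

Lemma ab_0l x : add zero x = x.
Proof. by case: H => _ [_ []]. Qed.

Lemma ab_Nl x : add (opp x) x = zero.
Proof. by case: H => _ [_ []]. Qed.

Lemma ab_0r x : add x zero = x.
Proof. by rewrite ab_comm ab_0l. Qed.

Lemma ab_Nr x : add x (opp x) = zero.
Proof. by rewrite ab_comm ab_Nl. Qed.

Lemma ab_ACA x y z t : add (add x y) (add z t) = add (add x z) (add y t).
Proof. by rewrite -!ab_assoc (ab_assoc y) (ab_comm y z) !ab_assoc. Qed.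

Lemma ab_idem0 x : add x x = x -> x = zero.
Proof. by move=> E; rewrite -{1}(ab_0l x) -{1}(ab_Nl x) -ab_assoc E ab_Nl. Qed.

Lemma ab_N_unique x y : add x y = zero -> x = opp y.
Proof. by move=> E; rewrite -(ab_0r x) -(ab_Nr y) ab_assoc E ab_0l. Qed.

Lemma ab_N0 : opp zero = zero.
Proof. by rewrite -{2}(ab_Nl zero) ab_0r. Qed.

Lemma ab_ND x y : opp (add x y) = add (opp x) (opp y).
Proof. by symmetry; apply: ab_N_unique; rewrite ab_ACA !ab_Nl ab_0l. Qed.

End AbelianGroups.

Section AdditiveMaps.
Variables (T U : Type) (add : T -> T -> T) (zero : T) (opp : T -> T).
Variables (add' : U -> U -> U) (zero' : U) (opp' : U -> U).
Hypotheses (H : abgrp_laws add zero opp) (H' : abgrp_laws add' zero' opp').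
Variable f : T -> U.
Hypothesis fD : forall x y, f (add x y) = add' (f x) (f y).

Lemma additive_0 : f zero = zero'.
Proof. by apply: (ab_idem0 H'); rewrite -fD (ab_0l H). Qed.

Lemma additive_N x : f (opp x) = opp' (f x).
Proof. by apply: (ab_N_unique H'); rewrite -fD (ab_Nl H) additive_0. Qed.

End AdditiveMaps.

Section Groups.
Variable G : Grp.
Implicit Types g h : G.

Lemma ginvr g : gmul g (ginv g) = gone G.
Proof.
rewrite -(gunitl (gmul g (ginv g))) -{1}(ginvl (ginv g)) -gassoc (gassoc (ginv g) g).
by rewrite ginvl gunitl ginvl.
Qed.

Lemma ginv_unique g h : gmul g h = gone G -> g = ginv h.
Proof. by move=> E; rewrite -(gunitr g) -(ginvr h) gassoc E gunitl. Qed.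

Lemma ginv_inv g : ginv (ginv g) = g.
Proof. by symmetry; apply: ginv_unique; apply: ginvr. Qed.

Lemma ginv_one : ginv (gone G) = gone G.
Proof. by symmetry; apply: ginv_unique; rewrite gunitl. Qed.

Lemma ginv_mul g h : ginv (gmul g h) = gmul (ginv h) (ginv g).
Proof.
symmetry; apply: ginv_unique.
by rewrite -gassoc (gassoc (ginv g)) ginvl gunitl ginvl.
Qed.

End Groups.

Section Rings.
Variables (G : Grp) (A : GRing G).
Implicit Types x y z : A.

Lemma radd_assoc x y z : radd x (radd y z) = radd (radd x y) z.
Proof. exact: (ab_assoc (r_ab A)). Qed.
Lemma radd_comm x y : radd x y = radd y x.
Proof. exact: (ab_comm (r_ab A)). Qed.
Lemma radd_0l x : radd (rzero A) x = x.
Proof. exact: (ab_0l (r_ab A)). Qed.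
Lemma radd_0r x : radd x (rzero A) = x.
Proof. exact: (ab_0r (r_ab A)). Qed.
Lemma radd_Nl x : radd (ropp x) x = rzero A.
Proof. exact: (ab_Nl (r_ab A)). Qed.
Lemma radd_Nr x : radd x (ropp x) = rzero A.
Proof. exact: (ab_Nr (r_ab A)). Qed.
Lemma radd_ACA x y z t : radd (radd x y) (radd z t) = radd (radd x z) (radd y t).
Proof. exact: (ab_ACA (r_ab A)). Qed.
Lemma ropp_add x y : ropp (radd x y) = radd (ropp x) (ropp y).
Proof. exact: (ab_ND (r_ab A)). Qed.
Lemma ropp_0 : ropp (rzero A) = rzero A.
Proof. exact: (ab_N0 (r_ab A)). Qed.

Lemma rmul0r x : rmul x (rzero A) = rzero A.
Proof. exact: (additive_0 (r_ab A) (r_ab A) (rmul_addr x)). Qed.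
Lemma rmul_Nr x y : rmul x (ropp y) = ropp (rmul x y).
Proof. exact: (additive_N (r_ab A) (r_ab A) (rmul_addr x)). Qed.
Lemma rmul_Nl x y : rmul (ropp x) y = ropp (rmul x y).
Proof.
exact: (additive_N (r_ab A) (r_ab A) (f := fun x => rmul x y) (fun u w => rmul_addl u w y)).
Qed.
Lemma ract_0 g : ract g (rzero A) = rzero A.
Proof. exact: (additive_0 (r_ab A) (r_ab A) (ract_add g)). Qed.
Lemma ract_Vr g x : ract g (ract (ginv g) x) = x.
Proof. by rewrite -ract_comp ginvr ract_one. Qed.
Lemma rsum_app (l l' : list A) : rsum (l ++ l') = radd (rsum l) (rsum l').
Proof. by elim: l => [|x l IH] /=; rewrite ?radd_0l // IH radd_assoc. Qed.

Lemma rmul_rsum (I : Type) (F : I -> A) (l : list I) x :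
  rmul x (rsum (map F l)) = rsum (map (fun i => rmul x (F i)) l).
Proof. by elim: l => [|y l IH] /=; rewrite ?rmul0r // rmul_addr IH. Qed.

Lemma rsum_rmul (I : Type) (F : I -> A) (l : list I) x :
  rmul (rsum (map F l)) x = rsum (map (fun i => rmul (F i) x) l).
Proof. by elim: l => [|y l IH] /=; rewrite ?rmul0l // rmul_addl IH. Qed.

Lemma ract_rsum (I : Type) (F : I -> A) (l : list I) g :
  ract g (rsum (map F l)) = rsum (map (fun i => ract g (F i)) l).
Proof. by elim: l => [|y l IH] /=; rewrite ?ract_0 // ract_add IH. Qed.

Lemma rsum_add (I : Type) (F F' : I -> A) (l : list I) :
  rsum (map (fun i => radd (F i) (F' i)) l) = radd (rsum (map F l)) (rsum (map F' l)).
Proof. by elim: l => [|y l IH] /=; rewrite ?radd_0l // IH radd_ACA. Qed.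

Lemma ropp_rsum (I : Type) (F : I -> A) (l : list I) :
  ropp (rsum (map F l)) = rsum (map (fun i => ropp (F i)) l).
Proof. by elim: l => [|y l IH] /=; rewrite ?ropp_0 // ropp_add IH. Qed.

Section Quadratik.
Hypothesis qA : quadratik A.
Variable P : A -> Prop.
Hypotheses (P0 : P (rzero A)) (PD : forall x y, P x -> P y -> P (radd x y)).

Lemma quadratik_ind : (forall x y, P (rmul x y)) -> forall x, P x.
Proof.
move=> PM x; case: (qA x) => l ->.
by elim: l => [|p l IH] //=; apply: PD.
Qed.
End Quadratik.

(** The decompositions below have three slots to fill, such as the vector, its coefficient and the
    functional of a rank-one operator. This is why elements are split into triple products. *)
Lemma quadratik_ind3 (P : A -> Prop) : quadratik A -> P (rzero A) ->
  (forall x y, P x -> P y -> P (radd x y)) ->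
  (forall x y z, P (rmul x (rmul y z))) -> forall x, P x.
Proof.
move=> qA P0 PD PM; apply: (quadratik_ind qA P0 PD) => x.
apply: (quadratik_ind qA) => [|y z Hy Hz|//]; first by rewrite rmul0r.
by rewrite rmul_addr; apply: PD.
Qed.

End Rings.

Lemma quad (G : Grp) (A : Obj G) : quadratik A.
Proof. by case: A. Qed.
Arguments quad {G} A.

Section Homs.
Variables (G : Grp).

Lemma hom_0 (A B : GRing G) (h : RHom A B) : h (rzero A) = rzero B.
Proof. exact: (additive_0 (r_ab A) (r_ab B) (hadd h)). Qed.

Lemma hom_N (A B : GRing G) (h : RHom A B) x : h (ropp x) = ropp (h x).
Proof. exact: (additive_N (r_ab A) (r_ab B) (hadd h)). Qed.

Lemma hom_rsum (A B : GRing G) (h : RHom A B) (I : Type) (F : I -> A) (l : list I) :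
  h (rsum (map F l)) = rsum (map (fun i => h (F i)) l).
Proof. by elim: l => [|y l IH] /=; rewrite ?hom_0 // hadd IH. Qed.

Definition hid (A : GRing G) : RHom A A :=
  {| hfun := fun x => x; hadd := fun _ _ => eq_refl; hmul := fun _ _ => eq_refl;
     hequiv := fun _ _ => eq_refl |}.

Definition hcomp (A B C : GRing G) (f : RHom A B) (g : RHom B C) : RHom A C.
Proof.
refine {| hfun := fun x => g (f x) |} => *.
- by rewrite !hadd.
- by rewrite !hmul.
- by rewrite !hequiv.
Defined.

Lemma isid_hid (A : GRing G) : isid (hid A).
Proof. by []. Qed.

End Homs.

Section Morphisms.
Variable G : Grp.
Implicit Types A B C D M X : Obj G.

Lemma meq_hcomp A B C (f : RHom A B) (g : RHom B C) :
  meq (mcomp (mhom f) (mhom g)) (mhom (hcomp f g)).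
Proof. exact: meq_homcomp. Qed.

Lemma meq_compl A B C (s s' : mor A B) (t : mor B C) :
  meq s s' -> meq (mcomp s t) (mcomp s' t).
Proof. by move=> H; apply: meq_comp => //; apply: meq_refl. Qed.

Lemma meq_compr A B C (s : mor A B) (t t' : mor B C) :
  meq t t' -> meq (mcomp s t) (mcomp s t').
Proof. by move=> H; apply: meq_comp => //; apply: meq_refl. Qed.

Arguments meq_compl {A B C s s' t}.
Arguments meq_compr {A B C s t t'}.

Lemma meq_1l A B (s : mor A B) : meq (mcomp (mhom (hid A)) s) s.
Proof. exact: meq_idl. Qed.

Lemma meq_1r A B (s : mor A B) : meq (mcomp s (mhom (hid B))) s.
Proof. exact: meq_idr. Qed.

Lemma meq_hcomp_comp A B C D (f : RHom A B) (g : RHom B C) (s : mor C D) :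
  meq (mcomp (mhom (hcomp f g)) s) (mcomp (mhom f) (mcomp (mhom g) s)).
Proof.
apply: (meq_trans (meq_compl (meq_sym (meq_hcomp _ _)))); exact (meq_sym (meq_assoc _ _ _)).
Qed.

Lemma meq_comp_hcomp A B C D (f : RHom B C) (g : RHom C D) (s : mor A B) :
  meq (mcomp s (mhom (hcomp f g))) (mcomp (mcomp s (mhom f)) (mhom g)).
Proof.
apply: (meq_trans (meq_compr (meq_sym (meq_hcomp _ _)))); exact (meq_assoc _ _ _).
Qed.

Lemma meq_plus0r A B (s : mor A B) : meq (mplus s (@mzr G A B)) s.
Proof. exact (meq_trans (meq_plusC _ _) (meq_plus0 _)). Qed.

Lemma meq_plus_idem A B (s : mor A B) : meq (mplus s s) s -> meq s (@mzr G A B).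
Proof.
move=> E.
apply: (meq_trans (meq_sym (meq_plus0 s))).
apply: (meq_trans (meq_plus (meq_sym (meq_plusN s)) (meq_refl s))).
apply: (meq_trans (meq_sym (meq_plusA _ _ _))).
exact (meq_trans (meq_plus (meq_refl _) E) (meq_plusN s)).
Qed.

Lemma meq_neg_unique A B (s t : mor A B) : meq (mplus s t) (@mzr G A B) -> meq s (mneg t).
Proof.
move=> E.
apply: (meq_trans (meq_sym (meq_plus0r s))).
apply: (meq_trans (meq_plus (meq_refl s) (meq_sym (meq_plusN t)))).
apply: (meq_trans (meq_plus (meq_refl s) (meq_plusC _ _))).
apply: (meq_trans (meq_plusA _ _ _)).
exact (meq_trans (meq_plus E (meq_refl _)) (meq_plus0 _)).
Qed.

Lemma meq_0comp A B C (s : mor B C) : meq (mcomp (@mzr G A B) s) (@mzr G A C).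
Proof.
apply: meq_plus_idem; apply: (meq_trans (meq_sym (meq_distl _ _ _))).
exact (meq_compl (meq_plus0 _)).
Qed.

Lemma meq_comp0 A B C (s : mor A B) : meq (mcomp s (@mzr G B C)) (@mzr G A C).
Proof.
apply: meq_plus_idem; apply: (meq_trans (meq_sym (meq_distr _ _ _))).
exact (meq_compr (meq_plus0 _)).
Qed.

Lemma meq_negcomp A B C (s : mor A B) (t : mor B C) :
  meq (mcomp (mneg s) t) (mneg (mcomp s t)).
Proof.
apply: meq_neg_unique; apply: (meq_trans (meq_sym (meq_distl _ _ _))).
exact (meq_trans (meq_compl (meq_plusN _)) (meq_0comp _ _)).
Qed.

Lemma meq_compneg A B C (s : mor A B) (t : mor B C) :
  meq (mcomp s (mneg t)) (mneg (mcomp s t)).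
Proof.
apply: meq_neg_unique; apply: (meq_trans (meq_sym (meq_distr _ _ _))).
exact (meq_trans (meq_compr (meq_plusN _)) (meq_comp0 _ _)).
Qed.

Lemma meq_negneg A B (s : mor A B) : meq (mneg (mneg s)) s.
Proof.
apply: meq_sym; apply: meq_neg_unique.
exact (meq_trans (meq_plusC _ _) (meq_plusN _)).
Qed.

Lemma meq_neg0 A B : meq (mneg (@mzr G A B)) (@mzr G A B).
Proof. by apply: meq_sym; apply: meq_neg_unique; apply: meq_plus0. Qed.

Lemma meq_negplus A B (s t : mor A B) : meq (mneg (mplus s t)) (mplus (mneg s) (mneg t)).
Proof.
apply: meq_sym; apply: meq_neg_unique.
apply: (meq_trans (meq_plusA _ _ _)).
apply: (meq_trans (t := mplus (mplus (mneg s) s) (mplus (mneg t) t))).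
- apply: meq_sym; apply: (meq_trans (meq_plusA _ _ _)); apply: meq_plus (meq_refl _).
  apply: (meq_trans (meq_sym (meq_plusA _ _ _))).
  apply: (meq_trans (meq_plus (meq_refl _) (meq_plusC _ _))); exact: meq_plusA.
- exact (meq_trans (meq_plus (meq_plusN _) (meq_plusN _)) (meq_plus0 _)).
Qed.

(** Holds because e^-1 e = 1 can be inserted in front of both morphisms. It serves to show that an
    endomorphism which fixes a corner is trivial in the category. *)
Lemma corner_cancel A B C (e : RHom A B) (s t : mor B C) : corner e ->
  meq (mcomp (mhom e) s) (mcomp (mhom e) t) -> meq s t.
Proof.
move=> He E.
have K (r : mor B C) : meq r (mcomp (minv e He) (mcomp (mhom e) r)).
  apply: meq_sym; apply: (meq_trans (meq_assoc _ _ _)).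
  exact (meq_trans (meq_compl (meq_inv2 He (@isid_hid G B))) (meq_1l _)).
exact (meq_trans (K s) (meq_trans (meq_compr E) (meq_sym (K t)))).
Qed.

Lemma inL0_meq A B (s t : mor A B) : meq s t -> inL0 t -> inL0 s.
Proof. by move=> E [l Hl]; exists l; apply: meq_trans Hl. Qed.

Lemma inL0_hom A B (h : RHom A B) : inL0 (mhom h).
Proof. by exists [(true, h)] => /=; apply: meq_sym; apply: meq_plus0r. Qed.

Lemma inL0_zero A B : inL0 (@mzr G A B).
Proof. by exists []; apply: meq_refl. Qed.

Lemma inL0_plus A B (s t : mor A B) : inL0 s -> inL0 t -> inL0 (mplus s t).
Proof.
move=> [l Hl] [l' Hl']; exists (l ++ l').
apply: (meq_trans (meq_plus Hl Hl')).
elim: l {Hl} => [|p l IH] /=; first exact: meq_plus0.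
apply: (meq_trans (meq_sym (meq_plusA _ _ _))).
exact (meq_plus (meq_refl _) IH).
Qed.

Lemma inL0_neg A B (s : mor A B) : inL0 s -> inL0 (mneg s).
Proof.
move=> [l Hl]; exists (map (fun p => (negb (fst p), snd p)) l).
apply: (meq_trans (meq_neg Hl)).
elim: l {Hl} => [|[b h] l IH] /=; first exact: meq_neg0.
apply: (meq_trans (meq_negplus _ _)); apply: meq_plus IH.
by case: b => /=; [apply: meq_refl | apply: meq_negneg].
Qed.

Lemma inL0_comp A B C (s : mor A B) (h : RHom B C) : inL0 s -> inL0 (mcomp s (mhom h)).
Proof.
move=> [l Hl]; exists (map (fun p => (fst p, hcomp (snd p) h)) l).
apply: (meq_trans (meq_compl Hl)).
elim: l {Hl} => [|[b k] l IH] /=; first exact: meq_0comp.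
apply: (meq_trans (meq_distl _ _ _)); apply: meq_plus IH.
case: b => /=; first exact: meq_hcomp.
apply: (meq_trans (meq_negcomp _ _)); apply: meq_neg; exact: meq_hcomp.
Qed.

Lemma inL0_compL0 A B C (s : mor A B) (t : mor B C) : inL0 s -> inL0 t -> inL0 (mcomp s t).
Proof.
move=> Hs [l Hl]; apply: (inL0_meq (meq_compr Hl)).
elim: l {Hl} => [|[b h] l IH] /=; first exact (inL0_meq (meq_comp0 _ _) (inL0_zero _ _)).
apply: (inL0_meq (meq_distr _ _ _)); apply: inL0_plus IH.
case: b => /=; first exact: inL0_comp.
by apply: (inL0_meq (meq_compneg _ _)); apply: inL0_neg; apply: inL0_comp.
Qed.

(** * Good homomorphisms and the Ore condition *)

Inductive good : forall A B : Obj G, RHom A B -> Prop :=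
| good_id A : good (hid A)
| good_corner A B (e : RHom A B) : corner e -> good e
| good_split A B M (j : RHom B M) (f : RHom M A) (s : RHom A M) : splitex j f s -> good j
| good_comp A B C (f : RHom A B) (g : RHom B C) : good f -> good g -> good (hcomp f g).

(** The generators are retracted by e^-1 and Delta_s, and a composite by the two retractions in
    reverse order. *)
Lemma good_split_mono A B (v : RHom A B) :
  good v -> exists w, meq (mcomp (mhom v) w) (mhom (hid A)).
Proof.
elim=> {A B v} [A|A B e He|A B M j f s H|A B C f g _ [w Hw] _ [u Hu]].
- by exists (mhom (hid A)); apply: meq_1l.
- by exists (minv e He); apply: meq_inv1.
- by exists (mdelta j f s H); apply: meq_delta1.
- exists (mcomp u w).
  apply: (meq_trans (meq_assoc _ _ _)).
  apply: (meq_trans (meq_compl (meq_compl (meq_sym (meq_hcomp _ _))))).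
  apply: (meq_trans (meq_compl (meq_sym (meq_assoc _ _ _)))).
  apply: (meq_trans (meq_compl (meq_compr Hu))).
  exact (meq_trans (meq_compl (meq_1r _)) Hw).
Qed.

Lemma good_cancel A B C (v : RHom B C) (s t : mor A B) : good v ->
  meq (mcomp s (mhom v)) (mcomp t (mhom v)) -> meq s t.
Proof.
move=> /good_split_mono [w Hw] E.
have K (r : mor A B) : meq r (mcomp (mcomp r (mhom v)) w).
  apply: meq_sym; apply: (meq_trans (meq_sym (meq_assoc _ _ _))).
  exact (meq_trans (meq_compr Hw) (meq_1r _)).
exact (meq_trans (K s) (meq_trans (meq_compl E) (meq_sym (K t)))).
Qed.

(** The square is required to commute in the category only; the squares constructed later need not
    commute as squares of ring maps. *)
Definition ore_along A B (v : RHom A B) : Prop :=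
  forall C (h : RHom A C), exists D (v' : RHom C D) (h' : RHom B D),
    good v' /\ meq (mcomp (mhom h) (mhom v')) (mcomp (mhom v) (mhom h')).

(** * Reduction to the Ore condition for generators *)

Section FromOre.
Hypothesis ore_corner : forall A B (e : RHom A B), corner e -> ore_along e.
Hypothesis ore_split : forall A B M (j : RHom B M) (f : RHom M A) (s : RHom A M),
  splitex j f s -> ore_along j.

(** Ore squares are pasted: the square along g is built over the map that closes the square along
    f. *)
Lemma ore_good A B (v : RHom A B) : good v -> ore_along v.
Proof.
elim=> {A B v} [A|A B e He|A B M j f s H|A B C f g _ IHf _ IHg].
- move=> C h; exists C, (hid C), h; split; first exact: good_id.
  exact (meq_trans (meq_1r _) (meq_sym (meq_1l _))).
- exact: ore_corner.
- exact: ore_split H.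
- move=> D h.
  have [D1 [f' [h1 [gf' E1]]]] := IHf D h.
  have [D2 [g' [h2 [gg' E2]]]] := IHg D1 h1.
  exists D2, (hcomp f' g'), h2; split; first exact: good_comp.
  apply: (meq_trans (meq_comp_hcomp _ _ _)); apply: (meq_trans (meq_compl E1)).
  apply: (meq_trans (meq_sym (meq_assoc _ _ _))); apply: (meq_trans (meq_compr E2)).
  apply: (meq_trans (meq_assoc _ _ _)); exact (meq_compl (meq_hcomp _ _)).
Qed.

(** For v = 1 this says that z enters L_0 after a good homomorphism. Allowing every good v makes the
    property stable under composition, and z' is taken in L_0 rather than among homomorphisms so
    that sums are covered. *)
Definition slides A B (z : mor A B) : Prop :=
  forall A' (v : RHom A A'), good v ->
  exists B' (w : RHom B B') (z' : mor A' B'),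
    good w /\ inL0 z' /\ meq (mcomp z (mhom w)) (mcomp (mhom v) z').

Lemma slides_hom A B (h : RHom A B) : slides (mhom h).
Proof.
move=> A' v /ore_good - /(_ _ h) [D [v' [h' [gv' E]]]].
by exists D, v', (mhom h'); split=> //; split=> //; apply: inL0_hom.
Qed.

Lemma slides_comp A B C (z : mor A B) (t : mor B C) :
  slides z -> slides t -> slides (mcomp z t).
Proof.
move=> Hz Ht A' v gv.
have [B' [w [z' [gw [Lz' Ez]]]]] := Hz _ v gv.
have [C' [u [t' [gu [Lt' Et]]]]] := Ht _ w gw.
exists C', u, (mcomp z' t'); split=> //; split; first exact: inL0_compL0.
apply: (meq_trans (meq_sym (meq_assoc _ _ _))); apply: (meq_trans (meq_compr Et)).
apply: (meq_trans (meq_assoc _ _ _)); apply: (meq_trans (meq_compl Ez)).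
exact (meq_sym (meq_assoc _ _ _)).
Qed.

(** A common denominator for v and w: the Ore condition along w is applied to v as the arbitrary
    homomorphism. It makes v' good, hence also v v'. *)
Lemma good_amalgamate B C D (v : RHom B C) (w : RHom B D) : good v -> good w ->
  exists X (v' : RHom C X) (w' : RHom D X), good (hcomp v v') /\
    meq (mcomp (mhom v) (mhom v')) (mcomp (mhom w) (mhom w')).
Proof.
move=> gv /ore_good - /(_ _ v) [X [v' [w' [gv' E]]]].
by exists X, v', w'; split=> //; apply: good_comp.
Qed.

Lemma slides_plus A B (z t : mor A B) : slides z -> slides t -> slides (mplus z t).
Proof.
move=> Hz Ht A' v gv.
have [B1 [w [z' [gw [Lz' Ez]]]]] := Hz _ v gv.
have [B2 [u [t' [gu [Lt' Et]]]]] := Ht _ v gv.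
have [X [w' [u' [gX E]]]] := good_amalgamate gw gu.
exists X, (hcomp w w'), (mplus (mcomp z' (mhom w')) (mcomp t' (mhom u'))).
split=> //; split; first by apply: inL0_plus; apply: inL0_comp.
apply: (meq_trans (meq_distl _ _ _)).
apply: meq_trans (meq_sym (meq_distr _ _ _)); apply: meq_plus.
- apply: (meq_trans (meq_comp_hcomp _ _ _)); apply: (meq_trans (meq_compl Ez)).
  exact (meq_sym (meq_assoc _ _ _)).
- apply: (meq_trans (meq_compr (meq_sym (meq_hcomp _ _)))).
  apply: (meq_trans (meq_compr E)).
  apply: (meq_trans (meq_assoc _ _ _)); apply: (meq_trans (meq_compl Et)).
  exact (meq_sym (meq_assoc _ _ _)).
Qed.

Lemma slides_neg A B (z : mor A B) : slides z -> slides (mneg z).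
Proof.
move=> Hz A' v gv; have [B1 [w [z' [gw [Lz' Ez]]]]] := Hz _ v gv.
exists B1, w, (mneg z'); split=> //; split; first exact: inL0_neg.
apply: (meq_trans (meq_negcomp _ _)); apply: (meq_trans (meq_neg Ez)).
exact (meq_sym (meq_compneg _ _)).
Qed.

Lemma slides_zero A B : slides (@mzr G A B).
Proof.
move=> A' v gv; exists B, (hid B), (@mzr G A' B); split; first exact: good_id.
split; first exact: inL0_zero.
exact (meq_trans (meq_0comp _ _) (meq_sym (meq_comp0 _ _))).
Qed.

(** The denominator starts with e itself, so e^-1 (e v) = v is already a homomorphism and z' can be
    the identity. *)
Lemma slides_inv A B (e : RHom A B) (H : corner e) : slides (minv e H).
Proof.
move=> B' v gv; exists B', (hcomp e v), (mhom (hid B')); split.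
  by apply: good_comp => //; apply: good_corner.
split; first exact: inL0_hom.
apply: (meq_trans (meq_comp_hcomp _ _ _)).
apply: (meq_trans (meq_compl (meq_inv2 H (@isid_hid G B)))).
exact (meq_trans (meq_1l _) (meq_sym (meq_1r _))).
Qed.

Lemma slides_delta A B M (j : RHom B M) (f : RHom M A) (s : RHom A M)
  (H : splitex j f s) : slides (mdelta j f s H).
Proof.
(* By [meq_delta2], Delta_s j equals 1 - f s, a signed sum of homomorphisms, which slides. The
   denominator for Delta_s is j followed by the one for d. *)
pose d := mplus (mhom (hid M)) (mneg (mhom (hcomp f s))).
have Ed : meq (mcomp (mdelta j f s H) (mhom j)) d.
  have E2 := meq_delta2 H (@isid_hid G M).
  apply: (meq_trans (meq_sym (meq_plus0r _))).
  apply: (meq_trans (meq_plus (meq_refl _) (meq_sym (meq_plusN (mhom (hcomp f s)))))).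
  apply: (meq_trans (meq_plus (meq_refl _) (meq_plusC _ _))).
  apply: (meq_trans (meq_plusA _ _ _)); apply: meq_plus (meq_refl _).
  apply: (meq_trans (meq_plus (meq_refl _) (meq_sym (meq_hcomp _ _)))).
  exact: E2.
have Hd : slides d.
  by apply: slides_plus; [apply: slides_hom | apply: slides_neg; apply: slides_hom].
move=> M' v gv; have [M1 [w [z' [gw [Lz' Ez]]]]] := Hd _ v gv.
exists M1, (hcomp j w), z'; split.
  by apply: good_comp => //; apply: good_split H.
split=> //.
apply: (meq_trans (meq_comp_hcomp _ _ _)).
exact (meq_trans (meq_compl Ed) Ez).
Qed.

Lemma slides_all A B (z : mor A B) : slides z.
Proof.
elim: z => {A B}.
- exact: slides_hom.
- exact: slides_inv.
- by move=> B M A j f s H; apply: slides_delta.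
- by move=> A B C s Hs t Ht; apply: slides_comp.
- by move=> A B s Hs t Ht; apply: slides_plus.
- by move=> A B s Hs; apply: slides_neg.
- exact: slides_zero.
Qed.

(** Each morphism gets its own denominator by sliding along the identity; the two denominators are
    then amalgamated. *)
Lemma into_L0 A B (s t : mor A B) : exists B' (v : RHom B B'),
  good v /\ inL0 (mcomp s (mhom v)) /\ inL0 (mcomp t (mhom v)).
Proof.
have [B1 [w [s' [gw [Ls Es]]]]] := slides_all s (good_id A).
have [B2 [u [t' [gu [Lt Et]]]]] := slides_all t (good_id A).
have [X [w' [u' [gX E]]]] := good_amalgamate gw gu.
exists X, (hcomp w w'); split=> //; split.
- apply: (inL0_meq (meq_compr (meq_sym (meq_hcomp _ _)))).
  apply: (inL0_meq (meq_assoc _ _ _)); apply: inL0_comp.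
  exact (inL0_meq (meq_trans Es (meq_1l _)) Ls).
- apply: (inL0_meq (meq_compr (meq_sym (meq_hcomp _ _)))).
  apply: (inL0_meq (meq_compr E)).
  apply: (inL0_meq (meq_assoc _ _ _)); apply: inL0_comp.
  exact (inL0_meq (meq_trans Et (meq_1l _)) Lt).
Qed.

(** Functoriality turns F s = F t into F (s v) = F (t v). Faithfulness on L_0 yields s v = t v, and
    v is cancelled in GK^G itself, not in the image of F. *)
Lemma faithful_from_L0 (D : Cat) (F : GKFunctor G D) : faithful_L0 F -> faithful F.
Proof.
move=> HF A B s t Est; have [B' [v [gv [Ls Lt]]]] := into_L0 s t.
apply: (good_cancel gv); apply: HF => //.
by rewrite !Fcomp Est.
Qed.

End FromOre.
End Morphisms.

Arguments meq_compl {G A B C s s' t}.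
Arguments meq_compr {G A B C s t t'}.

(** * Compact operators and rings of operators *)

Lemma fs_eq (G : Grp) (A : GRing G) (I : Type) (h h' : fs A I) :
  (forall i, fs_val h i = fs_val h' i) -> h = h'.
Proof.
case: h h' => [h H] [h' H'] /= E; apply: subset_eq_compat.
exact: functional_extensionality.
Qed.

Lemma fs_opp_pf (G : Grp) (A : GRing G) (I : Type) (h : fs A I) :
  exists l : list I, forall i, ~ In i l -> ropp (fs_val h i) = rzero A.
Proof. by case: h => h [l H] /=; exists l => i /H ->; apply: ropp_0. Qed.

Definition fs_opp (G : Grp) (A : GRing G) (I : Type) (h : fs A I) : fs A I :=
  exist _ (fun i => ropp (fs_val h i)) (fs_opp_pf h).

Section Modules.
Variables (G : Grp) (A : GRing G) (E : RMod A).

Lemma mact_0l (a : A) : mact (mzero E) a = mzero E.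
Proof.
exact: (additive_0 (m_ab E) (m_ab E) (f := fun x => mact x a) (fun x y => mact_addl x y a)).
Qed.
Lemma mS_0 g : mS g (mzero E) = mzero E.
Proof. exact: (additive_0 (m_ab E) (m_ab E) (mS_add g)). Qed.

(* The induction principle form of [E = E A]. *)
Definition module_full : Prop := forall P : E -> Prop, P (mzero E) ->
  (forall x y, P x -> P y -> P (madd x y)) -> (forall x a, P (mact x a)) -> forall x, P x.

End Modules.

Section Sums.
Variables (G : Grp) (A : GRing G) (E : FMod A) (I : Type).
Notation V := (Mty E I).
Notation addV := (@addM G A E I).
Notation zeroV := (@zeroM G A E I).
Implicit Types (m : V) (a : A) (K : V -> V) (psi : V -> A).

Definition oppM m : V := match m with (x, b, h) => (mopp x, ropp b, fs_opp h) end.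

Lemma M_ab : abgrp_laws addV zeroV oppM.
Proof.
split; [|split; [|split]].
- move=> [[x b] h] [[y c] k] [[z d] l] /=; rewrite (ab_assoc (m_ab E)) radd_assoc.
  by congr (_, _, _); apply: fs_eq => i /=; rewrite radd_assoc.
- move=> [[x b] h] [[y c] k] /=; rewrite (ab_comm (m_ab E)) radd_comm.
  by congr (_, _, _); apply: fs_eq => i /=; rewrite radd_comm.
- move=> [[x b] h] /=; rewrite (ab_0l (m_ab E)) radd_0l.
  by congr (_, _, _); apply: fs_eq => i /=; rewrite radd_0l.
- move=> [[x b] h] /=; rewrite (ab_Nl (m_ab E)) radd_Nl.
  by congr (_, _, _); apply: fs_eq => i /=; rewrite radd_Nl.
Qed.

Lemma actM_addl m m' a : actM (addV m m') a = addV (actM m a) (actM m' a).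
Proof.
case: m m' => [[x b] h] [[y c] k] /=; rewrite mact_addl rmul_addl.
by congr (_, _, _); apply: fs_eq => i /=; rewrite rmul_addl.
Qed.

Lemma actM_addr m a b : actM m (radd a b) = addV (actM m a) (actM m b).
Proof.
case: m => [[x c] h] /=; rewrite mact_addr rmul_addr.
by congr (_, _, _); apply: fs_eq => i /=; rewrite rmul_addr.
Qed.

Lemma actM_mul m a b : actM m (rmul a b) = actM (actM m a) b.
Proof.
case: m => [[x c] h] /=; rewrite mact_mul rmul_assoc.
by congr (_, _, _); apply: fs_eq => i /=; rewrite rmul_assoc.
Qed.

Lemma actM_0l a : actM zeroV a = zeroV.
Proof. exact: (additive_0 M_ab M_ab (f := fun m => actM m a) (fun m m' => actM_addl m m' a)). Qed.

Lemma actM_0r m : actM m (rzero A) = zeroV.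
Proof. exact: (additive_0 (r_ab A) M_ab (actM_addr m)). Qed.

Lemma oppM_act m a : oppM (actM m a) = actM (oppM m) a.
Proof.
symmetry.
exact: (additive_N M_ab M_ab (f := fun m => actM m a) (fun m m' => actM_addl m m' a)).
Qed.

Lemma sumM_app (l l' : list V) : sumM (l ++ l') = addV (sumM l) (sumM l').
Proof.
elim: l => [|m l IH]; first by rewrite (ab_0l M_ab).
change (addV m (sumM (l ++ l')) = addV (addV m (sumM l)) (sumM l')).
by rewrite IH (ab_assoc M_ab).
Qed.

Lemma ThetaM_hom psi : ThetaM psi ->
  (forall m m', psi (addV m m') = radd (psi m) (psi m')) /\
  (forall m a, psi (actM m a) = rmul (psi m) a).
Proof.
move=> [phi [c [l [Hphi ->]]]]; have [phiD phiM] := Theta_hom Hphi; split.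
- move=> [[x b] h] [[y d] k] /=; rewrite phiD rmul_addr [RHS]radd_ACA; congr radd.
  rewrite [RHS]radd_ACA; congr radd; rewrite -rsum_add.
  by congr rsum; apply: map_ext => p; rewrite rmul_addr.
- move=> [[x b] h] a /=; rewrite phiM !rmul_addl !rmul_assoc rsum_rmul.
  by congr (radd _ (radd _ (rsum _))); apply: map_ext => p; rewrite rmul_assoc.
Qed.

Definition right_linear (U : V -> V) : Prop :=
  (forall m m', U (addV m m') = addV (U m) (U m')) /\ (forall m a, U (actM m a) = actM (U m) a).

Lemma right_linear_0 (U : V -> V) : right_linear U -> U zeroV = zeroV.
Proof. by move=> [UD _]; apply: (additive_0 M_ab M_ab UD). Qed.

Lemma compactM_zero : compactM (fun _ : V => zeroV).
Proof. by exists []; split. Qed.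

Lemma compactM_add K K' : compactM K -> compactM K' -> compactM (fun m => addV (K m) (K' m)).
Proof.
move=> [l [Hl E1]] [l' [Hl' E2]]; exists (l ++ l'); split; first by apply/Forall_app.
by move=> m; rewrite map_app sumM_app -E1 -E2.
Qed.

Lemma compactM_rank1 m psi : ThetaM psi -> compactM (fun m' => actM m (psi m')).
Proof.
move=> H; exists [(m, psi)]; split; first by constructor.
by move=> m' /=; rewrite (ab_0r M_ab).
Qed.

Lemma compactM_ind (P : (V -> V) -> Prop) : P (fun _ => zeroV) ->
  (forall K K', P K -> P K' -> P (fun m => addV (K m) (K' m))) ->
  (forall m psi, ThetaM psi -> P (fun m' => actM m (psi m'))) ->
  forall K, compactM K -> P K.
Proof.
move=> P0 PD P1 K [l [Hl /functional_extensionality ->]].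
by elim: Hl => [//|[m psi] {}l Hp _ IH] /=; apply: PD; [apply: P1|].
Qed.

Lemma compactM_right_linear K : compactM K -> right_linear K.
Proof.
elim/compactM_ind => {K} [|K K' [KD KM] [KD' KM']|m psi /ThetaM_hom [psiD psiM]]; split.
- by move=> *; rewrite (ab_0l M_ab).
- by move=> *; rewrite actM_0l.
- by move=> m m'; rewrite KD KD' (ab_ACA M_ab).
- by move=> m a; rewrite KM KM' actM_addl.
- by move=> m1 m2; rewrite psiD actM_addr.
- by move=> m1 a; rewrite psiM actM_mul.
Qed.

Lemma compactM_compl U K : right_linear U -> compactM K -> compactM (fun m => U (K m)).
Proof.
move=> HU; have [UD UM] := HU; elim/compactM_ind => {K} [|K K' HK HK'|m psi Hpsi].
- rewrite right_linear_0 //; exact: compactM_zero.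
- rewrite (_ : (fun m => _) = (fun m => addV (U (K m)) (U (K' m)))); first exact: compactM_add.
  by apply: functional_extensionality => m; rewrite UD.
- rewrite (_ : (fun m => _) = (fun m' => actM (U m) (psi m'))); first exact: compactM_rank1.
  by apply: functional_extensionality => m'; rewrite UM.
Qed.

(** Composing a rank-one operator with W on the right changes its functional psi into psi W, so W
    has to act on the functional space. *)
Lemma compactM_compr (W : V -> V) K : (forall psi, ThetaM psi -> ThetaM (fun m => psi (W m))) ->
  compactM K -> compactM (fun m => K (W m)).
Proof.
move=> HW; elim/compactM_ind => {K} [|K K' HK HK'|m psi Hpsi].
- exact: compactM_zero.
- exact: compactM_add HK HK'.
- apply: (compactM_rank1 m (psi := fun m => psi (W m))); exact: HW.
Qed.

Lemma right_linear_opp : right_linear oppM.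
Proof. by split=> *; [rewrite (ab_ND M_ab) | rewrite oppM_act]. Qed.

Lemma ThetaM_corner c : ThetaM (fun m : V => rmul c (snd (fst m))).
Proof.
exists (fun _ => rzero A), c, []; split; first exact: Theta_zero.
by apply: functional_extensionality => -[[x b] h] /=; rewrite radd_0l radd_0r.
Qed.

(** Here the quadratik condition meets compactness: the corner operator of a product has rank one,
    with vector a and functional left multiplication by b. *)
Lemma e0_rank1 a b : e0 (rmul a b) =
  fun m : V => actM (mzero E, a, fs_zero A I) (rmul b (snd (fst m))).
Proof.
apply: functional_extensionality => -[[x c] h] /=; rewrite mact_0l rmul_assoc.
by congr (_, _, _); apply: fs_eq => i /=; rewrite rmul0l.
Qed.

End Sums.

Section OperatorRing.
Variables (G : Grp) (V : Type) (add : V -> V -> V) (zero : V) (opp : V -> V).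
Hypothesis Hab : abgrp_laws add zero opp.
Variable S : G -> V -> V.
Hypotheses (S_add : forall g x y, S g (add x y) = add (S g x) (S g y))
  (S_one : forall x, S (gone G) x = x) (S_mul : forall g h x, S (gmul g h) x = S g (S h x)).
Variables (Q : GRing G) (P : (V -> V) -> Q -> Prop).
Hypotheses (P_additive : forall T q, P T q -> forall x y, T (add x y) = add (T x) (T y))
  (P_zero : P (fun _ => zero) (rzero Q))
  (P_add : forall T q T' q', P T q -> P T' q' -> P (fun x => add (T x) (T' x)) (radd q q'))
  (P_opp : forall T q, P T q -> P (fun x => opp (T x)) (ropp q))
  (P_mul : forall T q T' q', P T q -> P T' q' -> P (fun x => T (T' x)) (rmul q q'))
  (P_act : forall g T q, P T q -> P (fun x => S g (T (S (ginv g) x))) (ract g q)).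

(** Operators carry a label in a second ring Q. With Q = 0 this gives the ring of compact operators;
    with Q = A it gives a semidirect product, where the operator need not determine its component in
    A. *)
Definition op_car : Type := { p : (V -> V) * Q | P (fst p) (snd p) }.
Definition op_fun (t : op_car) : V -> V := fst (proj1_sig t).
Definition op_snd (t : op_car) : Q := snd (proj1_sig t).
Definition mkop T q (H : P T q) : op_car := exist _ (T, q) H.

Lemma op_ok t : P (op_fun t) (op_snd t).
Proof. by case: t. Qed.

Lemma op_eq (t u : op_car) : (forall x, op_fun t x = op_fun u x) -> op_snd t = op_snd u -> t = u.
Proof.
case: t u => [[T q] H] [[T' q'] H']; rewrite /op_fun /op_snd /= => E1 E2.
apply: subset_eq_compat.
by rewrite E2 (functional_extensionality _ _ E1).
Qed.

Definition OpRing : GRing G.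
Proof.
refine {| rcar := op_car; radd := fun t u => mkop (P_add (op_ok t) (op_ok u));
  rzero := mkop P_zero; ropp := fun t => mkop (P_opp (op_ok t));
  rmul := fun t u => mkop (P_mul (op_ok t) (op_ok u));
  ract := fun g t => mkop (P_act g (op_ok t)) |}.
- split; [|split; [|split]] => *; apply: op_eq => *.
  + exact: (ab_assoc Hab).
  + exact: radd_assoc.
  + exact: (ab_comm Hab).
  + exact: radd_comm.
  + exact: (ab_0l Hab).
  + exact: radd_0l.
  + exact: (ab_Nl Hab).
  + exact: radd_Nl.
- by move=> *; apply: op_eq => //; apply: rmul_assoc.
- by move=> *; apply: op_eq => //; apply: rmul_addl.
- by move=> x y z; apply: op_eq => [v|]; [apply: (P_additive (op_ok x)) | apply: rmul_addr].
- by move=> g x y; apply: op_eq => [v|]; [apply: S_add | apply: ract_add].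
- move=> g x y; apply: op_eq => [v|]; last exact: ract_mul.
  by rewrite /op_fun /= -[S (ginv g) (S g _)]S_mul ginvl S_one.
- move=> x; apply: op_eq => [v|]; last exact: ract_one.
  by rewrite /op_fun /= ginv_one !S_one.
- move=> g h x; apply: op_eq => [v|]; last exact: ract_comp.
  by rewrite /op_fun /= ginv_mul !S_mul.
Defined.

End OperatorRing.

(** * The ring of compact operators on [E + A] *)

Definition zeroR (G : Grp) : GRing G.
Proof.
by refine {| rcar := unit; radd := fun _ _ => tt; rzero := tt; ropp := fun _ => tt;
  rmul := fun _ _ => tt; ract := fun _ _ => tt |}; repeat split; repeat case.
Defined.

Lemma quadratik_zeroR (G : Grp) : quadratik (zeroR G).
Proof. by case; exists []. Qed.

Section CompactRing.
Variables (G : Grp) (A : GRing G) (E : FMod A).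
Hypothesis qA : quadratik A.
Hypothesis fullE : module_full E.

(* [H_A] is just the distinguished copy of [A]: the other indices form the empty type. *)
Notation V := (Mty E Empty_set).
Notation addV := (@addM G A E Empty_set).
Notation zeroV := (@zeroM G A E Empty_set).
Definition idT : G -> fs A Empty_set -> fs A Empty_set := fun _ h => h.
Notation SV := (SM (E := E) idT).

Lemma fs_empty (h h' : fs A Empty_set) : h = h'.
Proof. by apply: fs_eq; case. Qed.

Lemma idT_action : T_action idT.
Proof. by split; [|split; [|split]] => // *; apply: fs_empty. Qed.

Lemma SV_add g (m m' : V) : SV g (addV m m') = addV (SV g m) (SV g m').
Proof. by case: m m' => [[x b] h] [[y c] k] /=; rewrite mS_add ract_add. Qed.

Lemma SV_act g (m : V) a : SV g (actM m a) = actM (SV g m) (ract g a).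
Proof.
case: m => [[x b] h] /=; rewrite mS_act ract_mul; congr (_, _, _); exact: fs_empty.
Qed.

Lemma SV_one (m : V) : SV (gone G) m = m.
Proof. by case: m => [[x b] h] /=; rewrite mS_one ract_one. Qed.

Lemma SV_mul g g' (m : V) : SV (gmul g g') m = SV g (SV g' m).
Proof. by case: m => [[x b] h] /=; rewrite mS_comp ract_comp. Qed.

Lemma ThetaM_empty (phi : E -> A) c : Theta phi ->
  ThetaM (fun m : V => radd (phi (fst (fst m))) (rmul c (snd (fst m)))).
Proof.
move=> H; exists phi, c, []; split=> //.
by apply: functional_extensionality => -[[x b] h] /=; rewrite radd_0r.
Qed.

Lemma ThetaM_emptyP (psi : V -> A) : ThetaM psi -> exists phi c, Theta phi /\
  psi = fun m => radd (phi (fst (fst m))) (rmul c (snd (fst m))).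
Proof.
move=> [phi [c [[|[[] _] _] [H ->]]]]; exists phi, c; split=> //.
by apply: functional_extensionality => -[[x b] h] /=; rewrite radd_0r.
Qed.

Lemma compactM_SV g (K : V -> V) : compactM K -> compactM (fun m => SV g (K (SV (ginv g) m))).
Proof.
elim/compactM_ind => {K} [|K K' HK HK'|m psi /ThetaM_emptyP [phi [c [Hphi ->]]]].
- rewrite (_ : (fun _ => _) = fun _ => zeroV); first exact: compactM_zero.
  by apply: functional_extensionality => m /=; rewrite mS_0 ract_0.
- rewrite (_ : (fun m => _) = (fun m =>
    addV (SV g (K (SV (ginv g) m))) (SV g (K' (SV (ginv g) m))))); first exact: compactM_add.
  by apply: functional_extensionality => m; rewrite SV_add.
- have H := ThetaM_empty (ract g c) (Theta_inv g Hphi).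
  move: (compactM_rank1 (SV g m) H); congr compactM.
  apply: functional_extensionality => -[[x b] h]; rewrite SV_act /=.
  by rewrite /= ract_add ract_mul ract_Vr.
Qed.

Definition KRing : GRing G.
Proof.
refine (OpRing (M_ab E Empty_set) (S := SV) SV_add SV_one SV_mul (Q := zeroR G)
  (P := fun K _ => compactM K) _ _ _ _ _ _).
- by move=> K _ /compactM_right_linear [].
- exact: compactM_zero.
- by move=> *; apply: compactM_add.
- by move=> *; apply: (compactM_compl (right_linear_opp E Empty_set)).
- by move=> K _ K' _ /compactM_right_linear H H'; apply: compactM_compl.
- by move=> *; apply: compactM_SV.
Defined.

Definition kfun (k : KRing) : V -> V := op_fun k.
Definition mkK (K : V -> V) (H : compactM K) : KRing :=
  mkop (P := fun K (_ : zeroR G) => compactM K) (q := tt) H.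

Lemma K_ok (k : KRing) : compactM (kfun k).
Proof. exact: (op_ok k). Qed.

Lemma K_eq (k k' : KRing) : (forall m, kfun k m = kfun k' m) -> k = k'.
Proof. by move=> H; apply: op_eq => //; case: (op_snd k); case: (op_snd k'). Qed.

Lemma e0_compact a : compactM (e0 (E := E) (I' := Empty_set) a).
Proof.
move: a; apply: (quadratik_ind qA) => [|a b Ha Hb|a b].
- rewrite (_ : e0 _ = fun _ => zeroV); first exact: compactM_zero.
  by apply: functional_extensionality => -[[x b] h] /=; rewrite rmul0l.
- rewrite (_ : e0 _ = fun m => addV (e0 a m) (e0 b m)); first exact: compactM_add.
  apply: functional_extensionality => -[[x c] h] /=.
  by rewrite rmul_addl (ab_0l (m_ab E)); congr (_, _, _); apply: fs_empty.
- rewrite e0_rank1; apply: compactM_rank1; exact: ThetaM_corner.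
Qed.

Lemma kfun_mk (K : V -> V) (H : compactM K) m : kfun (mkK H) m = K m.
Proof. by []. Qed.

Lemma kfun_add (k k' : KRing) m : kfun (radd k k') m = addV (kfun k m) (kfun k' m).
Proof. by []. Qed.

Lemma kfun_mul (k k' : KRing) m : kfun (rmul k k') m = kfun k (kfun k' m).
Proof. by []. Qed.

Lemma kfun_act g (k : KRing) m : kfun (ract g k) m = SV g (kfun k (SV (ginv g) m)).
Proof. by []. Qed.

Definition corner_hom : RHom A KRing.
Proof.
refine {| hfun := fun a => mkK (e0_compact a) |} => [a b|a b|g a]; apply: K_eq => -[[x c] h].
- rewrite kfun_add !kfun_mk /= rmul_addl (ab_0l (m_ab E)); congr (_, _, _); exact: fs_empty.
- by rewrite kfun_mul !kfun_mk /= rmul_assoc.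
- by rewrite kfun_act !kfun_mk /= mS_0 ract_mul ract_Vr.
Defined.

Definition cofull_dec (m : V) : Prop := exists l : list (V * (V -> A) * V)%type,
  List.Forall (fun p => ThetaM (snd (fst p))) l /\
  m = sumM (map (fun p => actM (fst (fst p)) (snd (fst p) (snd p))) l).

Lemma cofull_dec_add m m' : cofull_dec m -> cofull_dec m' -> cofull_dec (addV m m').
Proof.
move=> [l [Hl ->]] [l' [Hl' ->]]; exists (l ++ l'); split; first by apply/Forall_app.
by rewrite map_app sumM_app.
Qed.

Lemma cofull_dec_act m a b : cofull_dec (actM m (rmul a b)).
Proof.
exists [(m, (fun m' : V => rmul a (snd (fst m'))), (mzero E, b, fs_zero A Empty_set))]; split.
  by constructor; [apply: ThetaM_corner|constructor].
by rewrite [RHS](ab_0r (M_ab E Empty_set)).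
Qed.

(** The components in E and in A are treated separately. E = E A and A = A A reduce both to vectors
    m (a b), where a b is the value of left multiplication by a on the vector b of the distinguished
    copy. *)
Lemma cofull_empty : cofullM E Empty_set.
Proof.
have C0 : cofull_dec zeroV by exists [].
have CA (m : V) a : cofull_dec (actM m a).
  move: a; apply: (quadratik_ind qA) => [|a b Ha Hb|a b].
  - by rewrite actM_0r.
  - by rewrite actM_addr; apply: cofull_dec_add.
  - exact: cofull_dec_act.
have C1 : forall x, cofull_dec (x, rzero A, fs_zero A Empty_set).
  apply: fullE => [//|x y Hx Hy|x a].
  - move: (cofull_dec_add Hx Hy) => /=; rewrite radd_0l.
    by congr cofull_dec; congr (_, _, _); apply: fs_empty.
  - move: (CA (x, rzero A, fs_zero A Empty_set) a) => /=; rewrite rmul0l.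
    by congr cofull_dec; congr (_, _, _); apply: fs_empty.
have C2 : forall b, cofull_dec (mzero E, b, fs_zero A Empty_set).
  apply: (quadratik_ind qA) => [//|a b Ha Hb|a b].
  - move: (cofull_dec_add Ha Hb) => /=; rewrite (ab_0l (m_ab E)).
    by congr cofull_dec; congr (_, _, _); apply: fs_empty.
  - move: (CA (mzero E, a, fs_zero A Empty_set) b) => /=; rewrite mact_0l.
    by congr cofull_dec; congr (_, _, _); apply: fs_empty.
move=> [[x b] h]; move: (cofull_dec_add (C1 x) (C2 b)) => /=.
rewrite (ab_0r (m_ab E)) radd_0l => H.
rewrite (fs_empty h (fs_add (fs_zero A Empty_set) (fs_zero A Empty_set))).
exact: H.
Qed.

Lemma corner_hom_corner : corner corner_hom.
Proof.
exists E, Empty_set, idT; split; first exact: idT_action.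
split; first exact: cofull_empty.
exists kfun; split; [|split; [|split; [|split; [|split]]]] => //.
- by move=> k k' Ek; apply: K_eq => m; rewrite Ek.
- move=> K; split=> [H|[k <-]]; last exact: K_ok.
  by exists (mkK H).
Qed.

Definition products (k : KRing) : Prop := exists l : list (KRing * KRing)%type,
  k = rsum (map (fun p => rmul (fst p) (snd p)) l).

Lemma products_add k k' : products k -> products k' -> products (radd k k').
Proof. by move=> [l ->] [l' ->]; exists (l ++ l'); rewrite map_app rsum_app. Qed.

(** Cofullness writes m as a sum of m1 phi(m2), and the rank-one operator of m1 phi(m2) and psi is
    the product of those of (m1, phi) and (m2, psi). *)
Lemma quadratik_KRing : quadratik KRing.
Proof.
suff H (K : V -> V) : compactM K -> exists k, products k /\ kfun k = K.
  move=> k; have [k' [Pk' Ek]] := H _ (K_ok k).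
  rewrite (_ : k = k') //; apply: K_eq => m; by rewrite Ek.
elim/compactM_ind => {K} [|K K' [k [Pk <-]] [k' [Pk' <-]]|m psi Hpsi].
- by exists (rzero KRing); split=> //; exists [].
- by exists (radd k k'); split=> //; apply: products_add.
- have [l [Hl ->]] := cofull_empty m.
  elim: Hl => [|[[m1 phi] m2] {}l /= Hphi _ [k [Pk Ek]]].
    exists (rzero KRing); split; first by exists [].
    by apply: functional_extensionality => m'; rewrite [RHS]actM_0l.
  exists (radd (rmul (mkK (compactM_rank1 m1 Hphi)) (mkK (compactM_rank1 m2 Hpsi))) k); split.
    apply: products_add => //.
    exists [(mkK (compactM_rank1 m1 Hphi), mkK (compactM_rank1 m2 Hpsi))].
    exact (eq_sym (radd_0r _)).
  apply: functional_extensionality => m'; rewrite actM_addl -actM_mul.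
  have [_ <-] := ThetaM_hom Hphi.
  by rewrite kfun_add kfun_mul !kfun_mk Ek.
Qed.

End CompactRing.

(** * The two diagonal embeddings into 2 x 2 matrices agree *)

Definition regM (G : Grp) (R : GRing G) : FMod R.
Proof.
pose M := {| mcar := rcar R; madd := @radd G R; mzero := rzero R; mopp := @ropp G R;
  m_ab := r_ab R; mact := @rmul G R; mact_addl := @rmul_addl G R; mact_addr := @rmul_addr G R;
  mact_mul := @rmul_assoc G R; mS := @ract G R; mS_add := @ract_add G R; mS_act := @ract_mul G R;
  mS_one := @ract_one G R; mS_comp := @ract_comp G R |}.
refine {| fmod := M; Theta := fun phi : M -> R => exists c, forall x, phi x = rmul c x |}.
- by move=> phi [c Hc]; split=> *; rewrite !Hc; [apply: rmul_addr | apply: rmul_assoc].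
- by exists (rzero R) => x; rewrite rmul0l.
- by move=> phi psi [c Hc] [d Hd]; exists (radd c d) => x; rewrite Hc Hd rmul_addl.
- by move=> phi [c Hc]; exists (ropp c) => x; rewrite Hc rmul_Nl.
- by move=> a phi [c Hc]; exists (rmul a c) => x; rewrite Hc rmul_assoc.
- by move=> g phi [c Hc]; exists (ract g c) => x; rewrite Hc /= ract_mul ract_Vr.
Defined.

Lemma regM_full (G : Grp) (R : GRing G) : quadratik R -> module_full (regM R).
Proof. by move=> qR P P0 PD PM; apply: (quadratik_ind qR). Qed.

Lemma regM_Theta (G : Grp) (R : GRing G) (c : R) : Theta (f := regM R) (rmul c).
Proof. by exists c. Qed.

Section Conjugation.
Variables (G : Grp) (A : GRing G) (E : FMod A).
Notation V := (Mty E Empty_set).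
Notation SV := (SM (E := E) (@idT G A)).
Variable U : V -> V.
Hypotheses (U_linear : right_linear U) (UU : forall m, U (U m) = m)
  (U_Theta : forall psi, ThetaM psi -> ThetaM (fun m => psi (U m)))
  (U_S : forall g m, U (SV g m) = SV g (U m)).

Lemma conj_compact (K : V -> V) : compactM K -> compactM (fun m => U (K (U m))).
Proof. by move=> HK; apply: (compactM_compl U_linear); apply: compactM_compr. Qed.

(** U need not be compact; it acts as an invariant multiplier of the compact operators. As U is an
    involution, K -> U K U is multiplicative. *)
Definition conj_hom : RHom (KRing E) (KRing E).
Proof.
refine {| hfun := fun k => mkK (conj_compact (K_ok k)) |} => [k k'|k k'|g k]; apply: K_eq => m.
- by rewrite kfun_add !kfun_mk (proj1 U_linear).
- by rewrite kfun_mul !kfun_mk UU.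
- change (U (SV g (kfun k (SV (ginv g) (U m)))) = SV g (U (kfun k (U (SV (ginv g) m))))).
  by rewrite !U_S.
Defined.

Lemma conj_homE k m : kfun (conj_hom k) m = U (kfun k (U m)).
Proof. by []. Qed.

End Conjugation.

(** * The ring of 2 x 2 matrices *)

Record mat2 (T : Type) := Mat { m11 : T; m12 : T; m21 : T; m22 : T }.

Section Mat2.
Variables (G : Grp) (B : GRing G).

Definition M2 : GRing G.
Proof.
refine {| rcar := mat2 B;
  radd := fun M N => Mat (radd (m11 M) (m11 N)) (radd (m12 M) (m12 N))
                         (radd (m21 M) (m21 N)) (radd (m22 M) (m22 N));
  rzero := Mat (rzero B) (rzero B) (rzero B) (rzero B);
  ropp := fun M => Mat (ropp (m11 M)) (ropp (m12 M)) (ropp (m21 M)) (ropp (m22 M));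
  rmul := fun M N =>
    Mat (radd (rmul (m11 M) (m11 N)) (rmul (m12 M) (m21 N)))
        (radd (rmul (m11 M) (m12 N)) (rmul (m12 M) (m22 N)))
        (radd (rmul (m21 M) (m11 N)) (rmul (m22 M) (m21 N)))
        (radd (rmul (m21 M) (m12 N)) (rmul (m22 M) (m22 N)));
  ract := fun g M => Mat (ract g (m11 M)) (ract g (m12 M)) (ract g (m21 M)) (ract g (m22 M)) |}.
- split; [|split; [|split]].
  + by move=> *; congr Mat; apply: radd_assoc.
  + by move=> *; congr Mat; apply: radd_comm.
  + by case=> * /=; congr Mat; apply: radd_0l.
  + by case=> * /=; congr Mat; apply: radd_Nl.
- by move=> *; congr Mat; rewrite /= !rmul_addl !rmul_addr !rmul_assoc radd_ACA.
- by move=> *; congr Mat; rewrite /= !rmul_addl radd_ACA.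
- by move=> *; congr Mat; rewrite /= !rmul_addr radd_ACA.
- by move=> *; congr Mat; apply: ract_add.
- by move=> *; congr Mat; rewrite /= !ract_add !ract_mul.
- by move=> [*] /=; congr Mat; apply: ract_one.
- by move=> g h [*] /=; congr Mat; apply: ract_comp.
Defined.

Definition i11 : RHom B M2.
Proof.
refine {| hfun := fun b => (Mat b (rzero B) (rzero B) (rzero B) : M2) |} => *; congr Mat;
  by rewrite /= ?rmul0l ?rmul0r ?radd_0l ?ract_0 ?radd_0r.
Defined.

Definition i22 : RHom B M2.
Proof.
refine {| hfun := fun b => (Mat (rzero B) (rzero B) (rzero B) b : M2) |} => *; congr Mat;
  by rewrite /= ?rmul0l ?rmul0r ?radd_0l ?ract_0 ?radd_0r.
Defined.

(* Conjugation by the permutation matrix, and multiplication by it on the left and right. *)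
Definition flip : RHom M2 M2.
Proof.
refine {| hfun := fun M : M2 => (Mat (m22 M) (m21 M) (m12 M) (m11 M) : M2) |} => // *; congr Mat;
  exact: radd_comm.
Defined.

Definition flipl (M : M2) : M2 := Mat (m21 M) (m22 M) (m11 M) (m12 M).
Definition flipr (M : M2) : M2 := Mat (m12 M) (m11 M) (m22 M) (m21 M).

Lemma flipl_flipl M : flipl (flipl M) = M. Proof. by case: M. Qed.
Lemma mul_flipl M N : rmul M (flipl N) = rmul (flipr M) N.
Proof. by congr Mat; apply: radd_comm. Qed.
(** Each matrix position is handled on its own, through a b E_ij = (a E_ik) (b E_kj). *)
Lemma quadratik_M2 : quadratik B -> quadratik M2.
Proof.
move=> qB.
pose dec (M : M2) := exists l : list (M2 * M2)%type,
   M = rsum (map (fun p => rmul (fst p) (snd p)) l).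
have dD M N : dec M -> dec N -> dec (radd M N).
  by move=> [l ->] [l' ->]; exists (l ++ l'); rewrite map_app rsum_app.
have d0 : dec (rzero M2) by exists [].
have dM M N : dec (rmul M N) by exists [(M, N)]; exact (eq_sym (radd_0r _)).
pose z := rzero B.
have d1 b : dec (Mat b z z z).
  move: b; apply: (quadratik_ind qB) => [//|a b Ha Hb|a b].
  - by move: (dD _ _ Ha Hb); rewrite /= /z !radd_0l.
  - by move: (dM (Mat a z z z) (Mat b z z z)); rewrite /= /z ?rmul0l ?rmul0r ?radd_0r.
have d2 b : dec (Mat z b z z).
  move: b; apply: (quadratik_ind qB) => [//|a b Ha Hb|a b].
  - by move: (dD _ _ Ha Hb); rewrite /= /z !radd_0l.
  - by move: (dM (Mat a z z z) (Mat z b z z)); rewrite /= /z ?rmul0l ?rmul0r ?radd_0r.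
have d3 b : dec (Mat z z b z).
  move: b; apply: (quadratik_ind qB) => [//|a b Ha Hb|a b].
  - by move: (dD _ _ Ha Hb); rewrite /= /z !radd_0l.
  - by move: (dM (Mat z z a z) (Mat b z z z)); rewrite /= /z ?rmul0l ?rmul0r ?radd_0r.
have d4 b : dec (Mat z z z b).
  move: b; apply: (quadratik_ind qB) => [//|a b Ha Hb|a b].
  - by move: (dD _ _ Ha Hb); rewrite /= /z !radd_0l.
  - by move: (dM (Mat z z z a) (Mat z z z b)); rewrite /= /z ?rmul0l ?rmul0r ?radd_0r ?radd_0l.
move=> [a b c d]; move: (dD _ _ (dD _ _ (d1 a) (d2 b)) (dD _ _ (d3 c) (d4 d))).
by rewrite /= /z !radd_0l !radd_0r ?radd_0l.
Qed.

End Mat2.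

(** * Triviality of conjugation by the permutation matrix *)

Section FlipTrivial.
Variables (G : Grp) (B : Obj G).

Definition M2o : Obj G := {| oring := M2 B; oquad := quadratik_M2 (B := B) (quad B) |}.
Notation R := M2o.
(** Compact operators on two copies of R, that is, M_2(R). The corner embedding [e1] uses the
    second, distinguished copy and leaves the first one free. *)
Definition K2o : Obj G :=
  {| oring := KRing (regM R); oquad := quadratik_KRing (quad R) (regM_full (quad R)) |}.
Notation e1 := (corner_hom (regM R) (quad R) : RHom R K2o).
Notation V := (Mty (regM R) Empty_set).

Definition swapU : V -> V := fun m => match m with (x, b, h) => (b, x, h) end.
(** The permutation matrix multiplies the first copy only, so conjugation by this map fixes the
    image of [e1]. *)
Definition flipU : V -> V := fun m => match m with (x, b, h) => (flipl x, b, h) end.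

Lemma swap_linear : right_linear swapU.
Proof. by split; [move=> [[x b] h] [[y c] k] | move=> [[x b] h] a]. Qed.
Lemma flip_linear : right_linear flipU.
Proof. by split; [move=> [[x b] h] [[y c] k] | move=> [[x b] h] a]. Qed.
Lemma swap_swap m : swapU (swapU m) = m. Proof. by case: m => [[]]. Qed.
Lemma flip_flip m : flipU (flipU m) = m.
Proof. by case: m => [[x b] h]; rewrite /flipU flipl_flipl. Qed.
Lemma swap_S g m : swapU (SM (@idT G R) g m) = SM (@idT G R) g (swapU m).
Proof. by case: m => [[]]. Qed.
Lemma flip_S g m : flipU (SM (@idT G R) g m) = SM (@idT G R) g (flipU m).
Proof. by case: m => [[]]. Qed.

Lemma swap_Theta (psi : V -> R) : ThetaM psi -> ThetaM (fun m => psi (swapU m)).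
Proof.
move=> /ThetaM_emptyP [phi [c [[d Hd] ->]]].
move: (ThetaM_empty d (regM_Theta c)).
by congr ThetaM; apply: functional_extensionality => -[[x b] h]; rewrite Hd; apply: radd_comm.
Qed.

Lemma flip_Theta (psi : V -> R) : ThetaM psi -> ThetaM (fun m => psi (flipU m)).
Proof.
move=> /ThetaM_emptyP [phi [c [[d Hd] ->]]].
move: (ThetaM_empty c (regM_Theta (flipr d : R))).
congr ThetaM; apply: functional_extensionality => -[[x b] h].
by rewrite Hd; congr radd; symmetry; apply: mul_flipl.
Qed.

Definition Wh : RHom K2o K2o := conj_hom swap_linear swap_swap swap_Theta swap_S.
Definition Uh : RHom K2o K2o := conj_hom flip_linear flip_flip flip_Theta flip_S.

Lemma e1_corner : corner e1.
Proof. exact (corner_hom_corner (quad R) (regM_full (quad R))). Qed.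

(* [e1] is invertible and unaffected by [Uh], so [Uh] is trivial in the category;
   transported to the other diagonal block by [Wh], this trivializes [flip]. *)
Lemma meq_Uh : meq (mhom Uh) (mhom (hid K2o)).
Proof.
apply: (corner_cancel e1_corner); apply: meq_trans (meq_sym (meq_1r _)).
apply: meq_homcomp => a; apply: K_eq => -[[x b] h].
by rewrite conj_homE !kfun_mk.
Qed.

Lemma meq_flip : meq (mhom (flip B : RHom R R)) (mhom (hid R)).
Proof.
have WW : meq (mcomp (mhom Wh) (mhom Wh)) (mhom (hid K2o)).
  by apply: meq_homcomp => k; apply: K_eq => m; rewrite !conj_homE !swap_swap.
pose v : RHom R K2o := hcomp e1 Wh.
(* [Wh] carries R from the second copy to the first, where [Uh] conjugates by the permutation
   matrix; the two sides are equal as ring maps. *)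
have E : meq (mcomp (mhom (flip B : RHom R R)) (mhom v)) (mcomp (mhom v) (mhom Uh)).
  apply: (meq_trans (meq_hcomp _ _)); apply: meq_sym; apply: meq_homcomp => a.
  apply: K_eq => -[[x b] h]; rewrite !conj_homE !kfun_mk /=.
  by congr (_, _, _); congr Mat; apply: radd_comm.
have gv : exists w, meq (mcomp (mhom v) w) (mhom (hid R)).
  exists (mcomp (mhom Wh) (minv e1 e1_corner)).
  apply: meq_trans (meq_inv1 e1_corner (@isid_hid G R)).
  apply: (meq_trans (meq_hcomp_comp _ _ _)); apply: meq_compr.
  apply: (meq_trans (meq_assoc _ _ _)).
  exact (meq_trans (meq_compl WW) (meq_1l _)).
case: gv => w Hw.
(* With w a retraction of v: flip = flip v w = v Uh w = v w = 1. *)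
apply: (meq_trans (meq_sym (meq_1r _))).
apply: (meq_trans (meq_compr (meq_sym Hw))).
apply: (meq_trans (meq_assoc _ _ _)); apply: (meq_trans (meq_compl E)).
apply: meq_trans Hw; apply: meq_compl.
exact (meq_trans (meq_compr meq_Uh) (meq_1r _)).
Qed.

Lemma meq_i11_i22 : meq (mhom (i11 B : RHom B R)) (mhom (i22 B : RHom B R)).
Proof.
apply: (meq_trans (meq_sym (meq_1r _))).
apply: (meq_trans (meq_compr (meq_sym meq_flip))).
exact: meq_homcomp.
Qed.

End FlipTrivial.

(** * Pushing a compressible homomorphism along a homomorphism *)

(* [kappa m b] plays the role of [m v(b)] cut down to the corner [B] of [B'], and [cp_ker] says
   that the quotient of [B'] by the ideal generated by [v(B)] is [A], split by [s]. *)
Record compression (G : Grp) (B B' A : GRing G) (v : RHom B B') (f : RHom B' A) (s : RHom A B')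
    (kappa : B' -> B -> B) : Prop := {
  cp_fs : forall a, f (s a) = a;
  cp_fv : forall b, f (v b) = rzero A;
  cp_ker : forall m, f m = rzero A -> exists l : list (B' * B * B')%type,
    m = rsum (map (fun p => rmul (fst (fst p)) (rmul (v (snd (fst p))) (snd p))) l);
  cp_addl : forall m n b, kappa (radd m n) b = radd (kappa m b) (kappa n b);
  cp_addr : forall m b c, kappa m (radd b c) = radd (kappa m b) (kappa m c);
  cp_mulr : forall m b c, kappa m (rmul b c) = rmul (kappa m b) c;
  cp_v : forall b c, kappa (v b) c = rmul b c;
  cp_vl : forall b n c, kappa (rmul (v b) n) c = rmul b (kappa n c);
  cp_vr : forall m b c, kappa (rmul m (v b)) c = kappa m (rmul b c);
  cp_vm : forall m b n c, kappa (rmul m (rmul (v b) n)) c = rmul (kappa m b) (kappa n c);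
  cp_act : forall g m b, kappa (ract g m) (ract g b) = ract g (kappa m b) }.

(** * The induced module and the operators on it *)

Section InducedModule.
Variables (G : Grp) (B B' A C : GRing G) (v : RHom B B') (f : RHom B' A) (s : RHom A B').
Variables (kappa : B' -> B -> B) (h : RHom B C).
Hypothesis cp : compression v f s kappa.
Hypotheses (qB : quadratik B) (qC : quadratik C).

(* Model of [B' v(B) (x)_B C] modulo the elements killed by the pairing with [v(B) B']:
   the tensor [n v(b) (x) c] becomes the function [m |-> h (kappa (m n) b) c]. *)
Definition spanned (F : B' -> C) : Prop := exists l : list (B' * B * C)%type, forall m,
  F m = rsum (map (fun p => rmul (h (kappa (rmul m (fst (fst p))) (snd (fst p)))) (snd p)) l).

Lemma spanned_0 : spanned (fun _ => rzero C).
Proof. by exists []. Qed.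

Lemma spanned_add F F' : spanned F -> spanned F' -> spanned (fun m => radd (F m) (F' m)).
Proof. by move=> [l E] [l' E']; exists (l ++ l') => m; rewrite E E' map_app rsum_app. Qed.

Lemma spanned_opp F : spanned F -> spanned (fun m => ropp (F m)).
Proof.
move=> [l E]; exists (map (fun p => (fst p, ropp (snd p))) l) => m.
rewrite E ropp_rsum map_map; congr rsum; apply: map_ext => p /=; by rewrite rmul_Nr.
Qed.

Lemma spanned_act F c : spanned F -> spanned (fun m => rmul (F m) c).
Proof.
move=> [l E]; exists (map (fun p => (fst p, rmul (snd p) c)) l) => m.
rewrite E rsum_rmul map_map; congr rsum; apply: map_ext => p /=; by rewrite rmul_assoc.
Qed.

Lemma spanned_shift F n : spanned F -> spanned (fun m => F (rmul m n)).
Proof.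
move=> [l E]; exists (map (fun p => (rmul n (fst (fst p)), snd (fst p), snd p)) l) => m.
rewrite E map_map; congr rsum; apply: map_ext => p /=; by rewrite rmul_assoc.
Qed.

Lemma spanned_S F g : spanned F -> spanned (fun m => ract g (F (ract (ginv g) m))).
Proof.
move=> [l E].
exists (map (fun p => (ract g (fst (fst p)), ract g (snd (fst p)), ract g (snd p))) l) => m.
rewrite E ract_rsum map_map; congr rsum; apply: map_ext => p /=.
by rewrite ract_mul -hequiv -(cp_act cp) ract_mul ract_Vr.
Qed.

Lemma spanned_gen n b c : spanned (fun m => rmul (h (kappa (rmul m n) b)) c).
Proof. by exists [(n, b, c)] => m /=; rewrite radd_0r. Qed.

Lemma kappa_0 m : kappa m (rzero B) = rzero B.
Proof. exact: (additive_0 (r_ab B) (r_ab B) (cp_addr cp m)). Qed.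

(** This function stands for the tensor of v(b) and c. B' need not have a unit, so b is factored as
    b1 b2 and v(b1) takes the place of n in a generator. *)
Lemma spanned_col b c : spanned (fun m => rmul (h (kappa m b)) c).
Proof.
move: b; apply: (quadratik_ind qB) => [|b b' [l E] [l' E']|b b'].
- by exists [] => m /=; rewrite kappa_0 hom_0 rmul0l.
- exists (l ++ l') => m; rewrite map_app rsum_app -E -E'.
  by rewrite (cp_addr cp) hadd rmul_addl.
- by exists [(v b, b', c)] => m /=; rewrite radd_0r (cp_vr cp).
Qed.

Lemma spanned_additive F m n : spanned F -> F (radd m n) = radd (F m) (F n).
Proof.
move=> [l E]; rewrite !E -rsum_add; congr rsum; apply: map_ext => p.
by rewrite rmul_addl (cp_addl cp) hadd rmul_addl.
Qed.

Lemma spanned_0r F : spanned F -> F (rzero B') = rzero C.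
Proof. by move=> HF; apply: (ab_idem0 (r_ab C)); rewrite -spanned_additive // radd_0l. Qed.

(** Evaluation at m v(b) n separates into a factor in m and b and the value at n. This is what makes
    elements of the ideal generated by v(B) act with finite rank. *)
Lemma spanned_vm F m b n : spanned F ->
  F (rmul m (rmul (v b) n)) = rmul (h (kappa m b)) (F n).
Proof.
move=> [l E]; rewrite !E rmul_rsum; congr rsum; apply: map_ext => p.
by rewrite -!rmul_assoc (cp_vm cp) hmul rmul_assoc.
Qed.

Lemma spanned_vl F b n : spanned F -> F (rmul (v b) n) = rmul (h b) (F n).
Proof.
move=> [l E]; rewrite !E rmul_rsum; congr rsum; apply: map_ext => p.
by rewrite -!rmul_assoc (cp_vl cp) hmul rmul_assoc.
Qed.

Definition X : Type := { F : B' -> C | spanned F }.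
Definition xval (x : X) : B' -> C := proj1_sig x.
Definition mkX F (H : spanned F) : X := exist _ F H.

Lemma x_ok x : spanned (xval x). Proof. exact: (proj2_sig x). Qed.

Lemma X_eq (x y : X) : (forall m, xval x m = xval y m) -> x = y.
Proof.
case: x y => [F H] [F' H'] /= E; apply: subset_eq_compat; exact: functional_extensionality.
Qed.

Definition XM : RMod C.
Proof.
refine {| mcar := X; madd := fun x y => mkX (spanned_add (x_ok x) (x_ok y));
  mzero := mkX spanned_0; mopp := fun x => mkX (spanned_opp (x_ok x));
  mact := fun x c => mkX (spanned_act c (x_ok x)); mS := fun g x => mkX (spanned_S g (x_ok x)) |}.
- split; [|split; [|split]] => *; apply: X_eq => m.
  + exact: radd_assoc.
  + exact: radd_comm.
  + exact: radd_0l.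
  + exact: radd_Nl.
- by move=> *; apply: X_eq => m; apply: rmul_addl.
- by move=> *; apply: X_eq => m; apply: rmul_addr.
- by move=> *; apply: X_eq => m; apply: rmul_assoc.
- by move=> *; apply: X_eq => m; apply: ract_add.
- by move=> *; apply: X_eq => m; apply: ract_mul.
- by move=> x; apply: X_eq => m /=; rewrite ginv_one !ract_one.
- by move=> g k x; apply: X_eq => m /=; rewrite ginv_mul !ract_comp.
Defined.

(** Functionals are sums of evaluations with coefficients in C. Every point of B' is allowed, so
    translations by B' preserve the functional space. *)
Definition XF : FMod C.
Proof.
refine {| fmod := XM; Theta := fun chi : XM -> C => exists l : list (C * B')%type,
  forall x, chi x = rsum (map (fun p => rmul (fst p) (xval x (snd p))) l) |}.
- move=> chi [l E]; split=> *; rewrite !E.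
  + by rewrite -rsum_add; congr rsum; apply: map_ext => p; apply: rmul_addr.
  + by rewrite rsum_rmul; congr rsum; apply: map_ext => p; apply: rmul_assoc.
- by exists [].
- by move=> chi chi' [l E] [l' E']; exists (l ++ l') => x; rewrite E E' map_app rsum_app.
- move=> chi [l E]; exists (map (fun p => (ropp (fst p), snd p)) l) => x.
  by rewrite E ropp_rsum map_map; congr rsum; apply: map_ext => p /=; rewrite rmul_Nl.
- move=> c chi [l E]; exists (map (fun p => (rmul c (fst p), snd p)) l) => x.
  by rewrite E rmul_rsum map_map; congr rsum; apply: map_ext => p /=; rewrite rmul_assoc.
- move=> g chi [l E]; exists (map (fun p => (ract g (fst p), ract g (snd p))) l) => x.
  rewrite E ract_rsum map_map; congr rsum; apply: map_ext => p /=.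
  by rewrite ract_mul ract_Vr ginv_inv.
Defined.

Lemma Theta_eval c n : Theta (f := XF) (fun x => rmul c (xval x n)).
Proof. by exists [(c, n)] => x /=; rewrite radd_0r. Qed.

(** It suffices to treat the generators; there the coefficient c is a sum of products in C. *)
Lemma XF_full : module_full XF.
Proof.
move=> P P0 PD PM.
have Pgen n b c : P (mkX (spanned_gen n b c)).
  move: c; apply: (quadratik_ind qC) => [|c c' Hc Hc'|c c'].
  - by move: P0; congr P; apply: X_eq => m /=; rewrite rmul0r.
  - by move: (PD _ _ Hc Hc'); congr P; apply: X_eq => m /=; rewrite rmul_addr.
  - by move: (PM (mkX (spanned_gen n b c)) c'); congr P; apply: X_eq => m /=; rewrite rmul_assoc.
move=> [F HF]; have [l E] := HF.
elim: l F HF E => [|[[n b] c] l IH] F HF E.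
  by move: P0; congr P; apply: X_eq => m /=; rewrite E.
have H' : spanned (fun m => rsum (map (fun p =>
    rmul (h (kappa (rmul m (fst (fst p))) (snd (fst p)))) (snd p)) l)) by exists l.
by move: (PD _ _ (Pgen n b c) (IH _ H' (fun m => eq_refl))); congr P;
  apply: X_eq => m /=; rewrite E.
Qed.

Notation V := (Mty XF Empty_set).
Notation addV := (@addM G C XF Empty_set).
Notation zeroV := (@zeroM G C XF Empty_set).
Notation SV := (SM (E := XF) (@idT G C)).
Notation z0 := (fs_zero C Empty_set).

Definition actX (n : B') (x : X) : X := mkX (spanned_shift n (x_ok x)).
(** Right translation of functions corresponds to left multiplication by n on tensors; on the
    summand C the ring B' acts by zero. *)
Definition actV (n : B') : V -> V := fun m => match m with (x, _, _) => (actX n x, rzero C, z0) end.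

Lemma V_eq (x y : X) (b c : C) (k l : fs C Empty_set) : (forall m, xval x m = xval y m) -> b = c ->
  (x, b, k) = (y, c, l) :> V.
Proof. by move=> /X_eq -> ->; congr (_, _, _); apply: fs_empty. Qed.

Lemma actV_linear n : right_linear (actV n).
Proof.
split.
- by move=> [[x b] k] [[y c] l]; apply: V_eq => //; rewrite radd_0l.
- by move=> [[x b] k] c; apply: V_eq => //; rewrite rmul0l.
Qed.

Lemma actV_add m n y : actV (radd m n) y = addV (actV m y) (actV n y).
Proof.
case: y => [[x b] k]; apply: V_eq => [u|] /=; last by rewrite radd_0l.
by rewrite rmul_addr; apply: spanned_additive; apply: x_ok.
Qed.

Lemma actV_0 y : actV (rzero B') y = zeroV.
Proof.
apply: (ab_idem0 (M_ab XF Empty_set)); by rewrite -actV_add radd_0l.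
Qed.

Lemma actV_N n y : actV (ropp n) y = oppM (actV n y).
Proof. by apply: (ab_N_unique (M_ab XF Empty_set)); rewrite -actV_add radd_Nl actV_0. Qed.

Lemma actV_mul m n y : actV (rmul m n) y = actV m (actV n y).
Proof. by case: y => [[x b] k]; apply: V_eq => //= u; rewrite rmul_assoc. Qed.

Lemma actV_S g n y : SV g (actV n (SV (ginv g) y)) = actV (ract g n) y.
Proof.
case: y => [[x b] k]; apply: V_eq => [u|] /=; last exact: ract_0.
by rewrite ract_Vr ginv_inv ract_mul ract_Vr.
Qed.

(** Evaluation at p turns into evaluation at p n. Hence compact operators stay compact when
    multiplied by B' on the right. *)
Lemma actV_Theta n (psi : V -> C) : ThetaM psi -> ThetaM (fun y => psi (actV n y)).
Proof.
move=> /ThetaM_emptyP [chi [c [[l E] ->]]].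
have H : Theta (f := XF) (fun x => chi (actX n x)).
  exists (map (fun p => (fst p, rmul (snd p) n)) l) => x; rewrite E map_map; congr rsum.
move: (ThetaM_empty (rzero C) H); congr ThetaM.
by apply: functional_extensionality => -[[x b] k] /=; rewrite rmul0l rmul0r.
Qed.

Lemma compactM_ext (K K' : V -> V) : (forall y, K y = K' y) -> compactM K -> compactM K'.
Proof. by move=> /functional_extensionality ->. Qed.

(** By [cp_ker] one may take n = m v(b) n' with b = b1 b2 b3. By [spanned_vm] this acts as the
    rank-one operator whose vector is the tensor of m v(b1) and h(b2), and whose functional is h(b3)
    times evaluation at n'. *)
Lemma actV_compact n : f n = rzero A -> compactM (actV n).
Proof.
move=> /(cp_ker cp) [l ->]; elim: l => [|[[m b] n'] l IH].
  by apply: (compactM_ext (K := fun _ => zeroV)); [move=> y; rewrite actV_0 | apply: compactM_zero].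
suff H : compactM (actV (rmul m (rmul (v b) n'))).
  by apply: compactM_ext (compactM_add H IH) => y; rewrite -actV_add.
move: b; apply: (quadratik_ind3 qB) => [|b b' Hb Hb'|b1 b2 b3].
- apply: (compactM_ext (K := fun _ => zeroV)); last exact: compactM_zero.
  by move=> y; rewrite hom_0 rmul0l rmul0r actV_0.
- apply: compactM_ext (compactM_add Hb Hb') => y.
  by rewrite -actV_add hadd rmul_addl rmul_addr.
- have H := compactM_rank1 ((mkX (spanned_gen m b1 (h b2)), rzero C, z0) : V)
    (ThetaM_empty (E := XF) (rzero C) (Theta_eval (h b3) n')).
  apply: compactM_ext H => -[[x c] k]; apply: V_eq => [u|] /=; last by rewrite rmul0l.
  rewrite rmul0l radd_0r (rmul_assoc u) (spanned_vm _ _ _ (x_ok x)).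
  by rewrite !(cp_mulr cp) !hmul !rmul_assoc.
Qed.

(** The off-diagonal blocks: [colV] maps C to X by tensoring with v(b), and [rowV] maps X to C by
    pairing with v(b). *)
Definition colV (b : B) : V -> V :=
  fun y => match y with (_, c, _) => (mkX (spanned_col b c), rzero C, z0) end.
Definition rowV (b : B) : V -> V :=
  fun y => match y with (x, _, _) => (mzero XF, xval x (v b), z0) end.

Lemma colV_compact b : compactM (colV b).
Proof.
move: b; apply: (quadratik_ind3 qB) => [|b b' Hb Hb'|b1 b2 b3].
- apply: (compactM_ext (K := fun _ => zeroV)); last exact: compactM_zero.
  by move=> [[x c] k]; apply: V_eq => // u /=; rewrite kappa_0 hom_0 rmul0l.
- apply: compactM_ext (compactM_add Hb Hb') => -[[x c] k].
  apply: V_eq => [u|] /=; last exact: radd_0l.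
  by rewrite (cp_addr cp) hadd rmul_addl.
- have H := compactM_rank1 ((mkX (spanned_col b1 (h b2)), rzero C, z0) : V)
    (ThetaM_corner XF Empty_set (h b3)).
  apply: compactM_ext H => -[[x c] k]; apply: V_eq => [u|] /=; last by rewrite rmul0l.
  by rewrite !(cp_mulr cp) !hmul !rmul_assoc.
Qed.

Lemma rowV_compact b : compactM (rowV b).
Proof.
move: b; apply: (quadratik_ind3 qB) => [|b b' Hb Hb'|b1 b2 b3].
- apply: (compactM_ext (K := fun _ => zeroV)); last exact: compactM_zero.
  by move=> [[x c] k]; apply: V_eq => //; rewrite hom_0 (spanned_0r (x_ok x)).
- apply: compactM_ext (compactM_add Hb Hb') => -[[x c] k].
  apply: V_eq => [u|] /=; first exact: radd_0l.
  by rewrite hadd (spanned_additive _ _ (x_ok x)).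
- have H := compactM_rank1 ((mzero XF, h b1, z0) : V)
    (ThetaM_empty (E := XF) (rzero C) (Theta_eval (h b2) (v b3))).
  apply: compactM_ext H => -[[x c] k]; apply: V_eq => [u|] /=; first exact: rmul0l.
  by rewrite rmul0l radd_0r !hmul !(spanned_vl _ _ (x_ok x)) !rmul_assoc.
Qed.

Definition blockV (M : M2 B) : V -> V := fun y =>
  addV (addV (actV (v (m11 M)) y) (colV (m12 M) y)) (addV (rowV (m21 M) y) (e0 (h (m22 M)) y)).

Lemma blockV_compact M : compactM (blockV M).
Proof.
apply: compactM_add; apply: compactM_add.
- by apply: actV_compact; apply: (cp_fv cp).
- exact: colV_compact.
- exact: rowV_compact.
- exact: e0_compact.
Qed.

Lemma blockVE M x c k : blockV M (x, c, k) =
  (mkX (spanned_add (spanned_shift (v (m11 M)) (x_ok x)) (spanned_col (m12 M) c)),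
   radd (xval x (v (m21 M))) (rmul (h (m22 M)) c), z0).
Proof. by apply: V_eq => [u|] /=; rewrite ?radd_0l ?radd_0r. Qed.

(** Column after row is governed by [spanned_vm] and row after column by [cp_v], so the off-diagonal
    blocks multiply as matrix entries over B. *)
Definition block_hom : RHom (M2 B) (KRing XF).
Proof.
refine {| hfun := fun M => mkK (blockV_compact M) |} => [M N|M N|g M]; apply: K_eq => -[[x c] k].
- change (blockV (radd M N) (x, c, k) = addV (blockV M (x, c, k)) (blockV N (x, c, k))).
  rewrite !blockVE; apply: V_eq => [u|] /=.
  + by rewrite hadd rmul_addr (cp_addr cp) hadd rmul_addl (spanned_additive _ _ (x_ok x)) radd_ACA.
  + by rewrite !hadd rmul_addl (spanned_additive _ _ (x_ok x)) radd_ACA.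
- change (blockV (rmul M N) (x, c, k) = blockV M (blockV N (x, c, k))).
  have xo := x_ok x.
  rewrite !blockVE; apply: V_eq => [u|] /=.
  + rewrite hadd !hmul rmul_addr (spanned_additive _ _ xo) -!(rmul_assoc u) !(spanned_vm _ _ _ xo).
    rewrite (cp_addr cp) !(cp_mulr cp) (cp_vr cp) (cp_mulr cp) !hadd !hmul.
    by rewrite rmul_addl rmul_addr !rmul_assoc radd_ACA.
  + rewrite hadd !hmul (spanned_additive _ _ xo) !(spanned_vl _ _ xo) hadd !hmul rmul_addl rmul_addr.
    by rewrite (cp_v cp) hmul !rmul_assoc radd_ACA.
- change (blockV (ract g M) (x, c, k) = SV g (blockV M (SV (ginv g) (x, c, k)))).
  rewrite [SV (ginv g) _]/= !blockVE; apply: V_eq => [u|] /=.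
  + by rewrite ract_add !ract_mul ginv_inv !ract_Vr -(hequiv h) -(cp_act cp) ract_Vr -(hequiv v).
  + by rewrite ract_add !ract_mul !ract_Vr ginv_inv !hequiv.
Defined.

Lemma block_i22 b y : kfun (block_hom (i22 B b)) y = e0 (h b) y.
Proof.
case: y => [[x c] k]; change (blockV (i22 B b) (x, c, k) = e0 (h b) (x, c, k)).
have xo := x_ok x; rewrite blockVE; apply: V_eq => [u|] /=.
- by rewrite !hom_0 rmul0r (spanned_0r xo) kappa_0 hom_0 rmul0l radd_0l.
- by rewrite hom_0 (spanned_0r xo) radd_0l.
Qed.

Lemma block_i11 b y : kfun (block_hom (i11 B b)) y = actV (v b) y.
Proof.
case: y => [[x c] k]; change (blockV (i11 B b) (x, c, k) = actV (v b) (x, c, k)).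
have xo := x_ok x; rewrite blockVE; apply: V_eq => [u|] /=.
- by rewrite kappa_0 hom_0 rmul0l radd_0r.
- by rewrite !hom_0 (spanned_0r xo) rmul0l radd_0l.
Qed.

(* The semidirect product of the compact operators by [A], which acts through [s]. *)
Definition split_op (T : V -> V) (a : A) : Prop :=
  exists K, compactM K /\ T = fun y => addV (K y) (actV (s a) y).

Lemma split_op_linear T a : split_op T a -> right_linear T.
Proof.
move=> [K [/compactM_right_linear [KD KM] ->]]; have [aD aM] := actV_linear (s a); split.
- by move=> y y'; rewrite KD aD (ab_ACA (M_ab XF Empty_set)).
- by move=> y c; rewrite KM aM actM_addl.
Qed.

Lemma compact_split_op K : compactM K -> split_op K (rzero A).
Proof.
move=> HK; exists K; split=> //; apply: functional_extensionality => y.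
by rewrite hom_0 actV_0 (ab_0r (M_ab XF Empty_set)).
Qed.

Lemma split_op_add T a T' a' : split_op T a -> split_op T' a' ->
  split_op (fun y => addV (T y) (T' y)) (radd a a').
Proof.
move=> [K [HK ->]] [K' [HK' ->]]; exists (fun y => addV (K y) (K' y)); split.
  exact: compactM_add.
by apply: functional_extensionality => y; rewrite hadd actV_add (ab_ACA (M_ab XF Empty_set)).
Qed.

Lemma split_op_opp T a : split_op T a -> split_op (fun y => oppM (T y)) (ropp a).
Proof.
move=> [K [HK ->]]; exists (fun y => oppM (K y)); split.
  exact: compactM_compl (right_linear_opp XF Empty_set) HK.
by apply: functional_extensionality => y; rewrite hom_N actV_N (ab_ND (M_ab XF Empty_set)).
Qed.

Lemma split_op_mul T a T' a' : split_op T a -> split_op T' a' ->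
  split_op (fun y => T (T' y)) (rmul a a').
Proof.
move=> H [K' [HK' ->]]; have TL := split_op_linear H; have [TD _] := TL.
move: H => [K [HK ET]].
(* The product is T K' + K s(a') + s(a) s(a'). The first term is compact because T is right linear,
   the second because s(a') acts on functionals. *)
exists (fun y => addV (T (K' y)) (K (actV (s a') y))); split.
  apply: compactM_add; first exact: compactM_compl.
  by apply: compactM_compr HK; apply: actV_Theta.
apply: functional_extensionality => y; rewrite TD hmul actV_mul -(ab_assoc (M_ab XF Empty_set)).
by congr addM; rewrite ET.
Qed.

Lemma split_op_act g T a : split_op T a ->
  split_op (fun y => SV g (T (SV (ginv g) y))) (ract g a).
Proof.
move=> [K [HK ->]]; exists (fun y => SV g (K (SV (ginv g) y))); split.
  exact: compactM_SV.
by apply: functional_extensionality => y; rewrite SV_add actV_S hequiv.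
Qed.

Definition SplitRing : GRing G.
Proof.
refine (OpRing (M_ab XF Empty_set) (S := SV) (@SV_add _ _ XF) (@SV_one _ _ XF) (@SV_mul _ _ XF)
  (Q := A) (P := split_op) _ _ split_op_add split_op_opp split_op_mul split_op_act).
- by move=> T a /split_op_linear [].
- exact: compact_split_op (compactM_zero XF Empty_set).
Defined.

Definition mkS T a (H : split_op T a) : SplitRing := mkop (P := split_op) H.

Lemma S_eq (t u : SplitRing) : (forall y, op_fun t y = op_fun u y) -> op_snd t = op_snd u -> t = u.
Proof. exact: op_eq. Qed.

Definition split_j : RHom (KRing XF) SplitRing.
Proof.
refine {| hfun := fun k => mkS (compact_split_op (K_ok k)) |} => *; apply: S_eq => //.
- by rewrite /op_snd /= radd_0l.
- by rewrite /op_snd /= rmul0l.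
- by rewrite /op_snd /= ract_0.
Defined.

Definition split_f : RHom SplitRing A :=
  {| hfun := fun t : SplitRing => op_snd t; hadd := fun _ _ => eq_refl;
     hmul := fun _ _ => eq_refl; hequiv := fun _ _ => eq_refl |}.

(** The difference n - s(f n) lies in the kernel of f and therefore acts compactly. *)
Lemma actV_split_op n : split_op (actV n) (f n).
Proof.
exists (actV (radd n (ropp (s (f n))))); split.
  by apply: actV_compact; rewrite hadd hom_N (cp_fs cp) radd_Nr.
by apply: functional_extensionality => y; rewrite -actV_add -radd_assoc radd_Nl radd_0r.
Qed.

Definition act_hom : RHom B' SplitRing.
Proof.
refine {| hfun := fun n => mkS (actV_split_op n) |} => [m n|m n|g n]; apply: S_eq => [y|].
- exact: actV_add.
- exact: hadd.
- exact: actV_mul.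
- exact: hmul.
- exact (eq_sym (actV_S g n y)).
- exact: hequiv.
Defined.

Lemma splitex_SplitRing : splitex split_j split_f (hcomp s act_hom).
Proof.
split; [|split; [|split]].
- move=> k k' E; apply: K_eq => y; exact: (f_equal (fun t : SplitRing => op_fun t y) E).
(* An element with label zero equals its compact part, since s(0) acts by zero. *)
- move=> t; split=> [[k <-] //|Ht].
  have [K [HK ET]] := op_ok t.
  exists (mkK HK); apply: S_eq => [y|]; last exact (eq_sym Ht).
  change (K y = op_fun t y); rewrite ET.
  have -> : op_snd t = rzero A by exact: Ht.
  by rewrite hom_0 actV_0 (ab_0r (M_ab XF Empty_set)).
- by move=> a; exists (act_hom (s a)); apply: (cp_fs cp).
- by move=> a; apply: (cp_fs cp).
Qed.

Hypothesis qA : quadratik A.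

(** The compact part is decomposed in [KRing XF], and the part coming from s in A. *)
Lemma quadratik_SplitRing : quadratik SplitRing.
Proof.
move=> t; have [K [HK ET]] := op_ok t.
have [l El] := quadratik_KRing qC XF_full (mkK HK); have [l' El'] := qA (op_snd t).
exists (map (fun p => (split_j (fst p), split_j (snd p))) l ++
        map (fun p => (act_hom (s (fst p)), act_hom (s (snd p)))) l').
rewrite map_app rsum_app !map_map.
have -> : rsum (map (fun p => rmul (split_j (fst p)) (split_j (snd p))) l) = split_j (mkK HK).
  by rewrite El hom_rsum; congr rsum; apply: map_ext => p; rewrite hmul.
have -> : rsum (map (fun p => rmul (act_hom (s (fst p))) (act_hom (s (snd p)))) l') =
    act_hom (s (op_snd t)).
  by rewrite [in RHS]El' !hom_rsum; congr rsum; apply: map_ext => p; rewrite !hmul.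
apply: S_eq => [y|]; first by rewrite ET.
change (op_snd t = radd (rzero A) (f (s (op_snd t)))).
by rewrite (cp_fs cp) radd_0l.
Qed.

End InducedModule.

(** As ring maps, h e = i22 rho and i11 rho j = v h'. The equality of [i11] and [i22] in the
    category joins these into h e j = v h'. *)
Lemma compression_ore (G : Grp) (B B' A : Obj G) (v : RHom B B') (f : RHom B' A) (s : RHom A B')
  (kappa : B' -> B -> B) : compression v f s kappa -> ore_along v.
Proof.
move=> cp C h; have qB := quad B; have qC := quad C; have qA := quad A.
pose XC := XF h cp.
pose L : Obj G :=
  {| oring := KRing XC; oquad := quadratik_KRing qC (XF_full (h := h) (cp := cp) qC) |}.
pose D : Obj G :=
  {| oring := SplitRing h cp; oquad := quadratik_SplitRing (h := h) (cp := cp) qB qC qA |}.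
pose e : RHom C L := corner_hom XC qC.
pose j : RHom L D := split_j h cp.
pose h' : RHom B' D := act_hom h cp qB.
pose rho : RHom (M2o B) L := block_hom h cp qB qC.
exists D, (hcomp e j), h'; split.
  apply: good_comp; first by apply: good_corner; apply: corner_hom_corner; apply: XF_full.
  exact (@good_split G A L D j (split_f h cp) (hcomp s h') (splitex_SplitRing h cp qB)).
apply: (meq_trans (meq_comp_hcomp _ _ _)).
have E1 : meq (mcomp (mhom h) (mhom e)) (mcomp (mhom (i22 B : RHom B (M2o B))) (mhom rho)).
  apply: (meq_trans (meq_hcomp _ _)); apply: meq_sym; apply: meq_homcomp => b.
  by apply: K_eq => y; apply: eq_sym; apply: block_i22.
have E2 : meq (mcomp (mcomp (mhom (i11 B : RHom B (M2o B))) (mhom rho)) (mhom j))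
    (mcomp (mhom v) (mhom h')).
  apply: (meq_trans (meq_compl (meq_hcomp _ _))).
  apply: (meq_trans (meq_hcomp _ _)); apply: meq_sym; apply: meq_homcomp => b.
  by apply: S_eq => [y|]; [apply: block_i11 | apply: eq_sym; apply: (cp_fv cp)].
apply: (meq_trans (meq_compl E1)); apply: meq_trans E2.
by apply: meq_compl; apply: meq_compl; apply: meq_sym; apply: meq_i11_i22.
Qed.

(** * Split ideals and corner embeddings are compressible *)

(** As j(B) is an ideal, kappa m b is the element that j sends to m j(b), and its identities are
    checked after applying the injective j. *)
Lemma split_compression (G : Grp) (B M A : Obj G) (j : RHom B M) (f : RHom M A) (s : RHom A M) :
  splitex j f s -> exists kappa, compression j f s kappa.
Proof.
move=> [jI [jf [_ fs]]].
have fj b : f (j b) = rzero A by apply/jf; exists b.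
have [kappa Hk] : exists kappa : M -> B -> B, forall m b, j (kappa m b) = rmul m (j b).
  have X m b : exists b', j b' = rmul m (j b) by apply/jf; rewrite hmul fj rmul0r.
  exists (fun m b => proj1_sig (constructive_indefinite_description _ (X m b))) => m b.
  by case: constructive_indefinite_description.
exists kappa; split=> //.
(* The kernel of f is j(B), and j(b c d) = j(b) j(c) j(d) has the required form. *)
- move=> m /jf [b <-]; move: b; apply: (quadratik_ind3 (quad B)).
  + by exists []; rewrite hom_0.
  + move=> b c [l El] [l' El']; exists (l ++ l').
    by rewrite hadd map_app rsum_app -El -El'.
  + by move=> b c d; exists [(j b, c, j d)]; rewrite /= radd_0r !hmul.
- by move=> *; apply: jI; rewrite hadd !Hk rmul_addl.
- by move=> *; apply: jI; rewrite hadd !Hk hadd rmul_addr.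
- by move=> *; apply: jI; rewrite hmul !Hk hmul rmul_assoc.
- by move=> *; apply: jI; rewrite Hk hmul.
- by move=> *; apply: jI; rewrite hmul !Hk rmul_assoc.
- by move=> *; apply: jI; rewrite !Hk hmul rmul_assoc.
- by move=> *; apply: jI; rewrite hmul !Hk !rmul_assoc.
- by move=> *; apply: jI; rewrite hequiv !Hk hequiv ract_mul.
Qed.

Definition zeroO (G : Grp) : Obj G := {| oring := zeroR G; oquad := @quadratik_zeroR G |}.

Definition to_zero (G : Grp) (A : GRing G) : RHom A (zeroR G).
Proof. by refine {| hfun := fun _ : A => rzero (zeroR G) |}. Defined.

Definition from_zero (G : Grp) (A : GRing G) : RHom (zeroR G) A.
Proof.
by refine {| hfun := fun _ : zeroR G => rzero A |} => *; rewrite ?radd_0l ?rmul0l ?ract_0.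
Defined.

(** Here kappa m b is the distinguished coordinate of the operator m applied to b in the
    distinguished copy. The complement is zero, so cofullness has to show that e(B) generates all of
    B' as an ideal. *)
Lemma corner_compression (G : Grp) (B B' : Obj G) (e : RHom B B') :
  corner e -> exists kappa, compression e (to_zero B') (from_zero B') kappa.
Proof.
move=> [E [I [T [[_ [TA _]] [cofull [psi [psiD [psiM [psiI [psiK [psiG psie]]]]]]]]]]].
pose del (b : B) : Mty E I := (mzero E, b, fs_zero B I).
pose kappa (m : B') (b : B) : B := snd (fst (psi m (del b))).
have psiL m : right_linear (psi m) by apply: compactM_right_linear; apply/psiK; exists m.
have sndD (y y' : Mty E I) : snd (fst (addM y y')) = radd (snd (fst y)) (snd (fst y')).
  by case: y y' => [[]] ? ? ? [[]].
have sndA (y : Mty E I) a : snd (fst (actM y a)) = rmul (snd (fst y)) a by case: y => [[]].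
have delD b c : del (radd b c) = addM (del b) (del c).
  by rewrite /= (ab_0l (m_ab E)); congr (_, _, _); apply: fs_eq => i /=; rewrite radd_0l.
have delA b c : del (rmul b c) = actM (del b) c.
  by rewrite /= mact_0l; congr (_, _, _); apply: fs_eq => i /=; rewrite rmul0l.
(* Compatibility with the module structure applied to 0 = 0 . 0, where the last factor is the zero
   of B. *)
have T0 g : T g (fs_zero B I) = fs_zero B I.
  have Z (k : fs B I) : fs_act k (rzero B) = fs_zero B I.
    by apply: fs_eq => i /=; rewrite rmul0r.
  by rewrite -{1}(Z (fs_zero B I)) TA ract_0.
have delS g b : SM T g (del b) = del (ract g b) by rewrite /= mS_0 T0.
have e0E b (y : Mty E I) : psi (e b) y = del (rmul b (snd (fst y))).
  by rewrite psie; case: y => [[]].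
have psi0 y : psi (rzero B') y = zeroM E I.
  by apply: (ab_idem0 (M_ab E I)); rewrite -[addM _ _](f_equal (fun F => F y) (psiD _ _)) radd_0l.
exists kappa; split=> //.
- by move=> [].
- move=> m _.
  pose sum_of (l : list (B' * B * B')%type) : B' :=
    rsum (map (fun p => rmul (fst (fst p)) (rmul (e (snd (fst p))) (snd p))) l).
  pose dec (K : Mty E I -> Mty E I) := exists l, psi (sum_of l) = K.
  suff H K : compactM K -> dec K.
    have [|l El] := H (psi m); first by apply/psiK; exists m.
    by exists l; apply: psiI.
  have dec0 : dec (fun _ => zeroM E I) by exists []; apply: functional_extensionality.
  have decD K1 K2 K3 : (forall y, K3 y = addM (K1 y) (K2 y)) -> dec K1 -> dec K2 -> dec K3.
    move=> E3 [l E1] [l' E2]; exists (l ++ l').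
    by rewrite /sum_of map_app rsum_app psiD -/(sum_of l) E1 -/(sum_of l') E2;
      apply: functional_extensionality.
  elim/compactM_ind => {K} [//|K K'|y phi Hphi]; first exact: decD.
  (* Cofullness turns y into a sum of y1 chi(y2), whose coefficient chi(y2) is then split into
     triple products. *)
  have [l [Hl ->]] := cofull y.
  elim: Hl => [|[[y1 chi] y2] {}l _ _ IH].
    have -> : (fun m' => actM (sumM []) (phi m')) = fun _ => zeroM E I; last exact: dec0.
    by apply: functional_extensionality => y'; apply: actM_0l.
  apply: (decD _ _ _ _ _ IH); first by move=> y'; apply: actM_addl.
  rewrite /=; move: (chi y2); apply: (quadratik_ind3 (quad B)).
  + rewrite actM_0r.
    have -> : (fun m' => actM (zeroM E I) (phi m')) = fun _ => zeroM E I; last exact: dec0.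
    by apply: functional_extensionality => y'; apply: actM_0l.
  + move=> b c; apply: decD => y'; by rewrite actM_addr actM_addl.
  (* The operator of y1 b c d and phi factors as m1 e(c) m2: m2 sends a vector into the
     distinguished copy as d phi, e(c) multiplies by c, and m1 multiplies by b and moves the result
     to y1. *)
  + move=> b c d.
    have /psiK [m1 E1] := compactM_rank1 y1 (ThetaM_corner E I b).
    have /psiK [m2 E2] := compactM_rank1 (del d) Hphi.
    exists [(m1, c, m2)]; rewrite /sum_of /= radd_0r !psiM E1 E2.
    apply: functional_extensionality => y'; rewrite e0E sndA /= -actM_mul.
    by rewrite !rmul_assoc.
- by move=> m n b; rewrite /kappa psiD sndD.
- by move=> m b c; rewrite /kappa delD (proj1 (psiL m)) sndD.
- by move=> m b c; rewrite /kappa delA (proj2 (psiL m)) sndA.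
- by move=> b c; rewrite /kappa e0E.
- by move=> b n c; rewrite /kappa psiM e0E.
- by move=> m b c; rewrite /kappa psiM e0E.
- by move=> m b n c; rewrite /kappa !psiM e0E delA (proj2 (psiL m)) sndA.
- move=> g m b; rewrite /kappa psiG delS -ract_comp ginvl ract_one.
  by case: (psi m (del b)) => [[]].
Qed.

(** * The Ore condition for the generators and the conclusion *)

Lemma ore_corner (G : Grp) (A B : Obj G) (e : RHom A B) : corner e -> ore_along e.
Proof.
move=> /corner_compression [kappa cp].
(* With zero complement the semidirect product reduces to the compact operators. *)
exact: (compression_ore (A := zeroO G) cp).
Qed.

Lemma ore_split (G : Grp) (A B M : Obj G) (j : RHom B M) (f : RHom M A) (s : RHom A M) :
  splitex j f s -> ore_along j.
Proof. by move=> /split_compression [kappa cp]; exact: (compression_ore cp). Qed.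

Theorem theorem10p8 (G : Grp) (D : Cat) (F : GKFunctor G D) :
  faithful F <-> faithful_L0 F.
Proof.
split; first by move=> HF A B s t _ _; apply: HF.
by apply: faithful_from_L0; [apply: ore_corner | apply: ore_split].
Qed.
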